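(* Let $\mathbf X=(X_t)_{t\in I}$ be an OPM process with orthogonal polynomial martingales $\{p_n(x;t)\}_{n\ge0}$, whose one-dimensional laws $\mu(\cdot,t)$ and transition laws $\eta(\cdot,t;y,s)$ satisfy: for all $s<t$ and $y\in\operatorname{supp}\mu(\cdot,s)$, $\eta(\cdot,t;y,s)\ll\mu(\cdot,t)$ with Radon–Nikodym derivative square integrable with respect to $\mu(\cdot,t)$. Let the polynomials satisfy the three-term recurrence $$xp_n(x;t)=\alpha_{n+1}(t)p_{n+1}(x;t)+\beta_n(t)p_n(x;t)+\gamma_{n-1}(t)p_{n-1}(x;t),\quad p_{-1}=0,\ p_0=1.$$ Then $\mathbf X$ is a harness if and only if $$\beta_n(t)=\beta_0(t)+b_n\alpha_1(t)+\hat b_n\gamma_0(t),\quad \alpha_n(t)=a_n\alpha_1(t)+\hat a_n\gamma_0(t),\quad \gamma_n(t)=c_n\alpha_1(t)+\hat c_n\gamma_0(t)$$ for all $n$ and $t\in I$, where $\{a_n,\hat a_n,b_n,\hat b_n,c_n,\hat c_n\}_{n\ge0}$ are real number sequences with $b_0=\hat b_0=\hat a_0=a_0=\hat a_1=c_0=0$, $a_1=\hat c_0=1$, and $\alpha_n(t)\gamma_{n-1}(t)>0$ for all $t\in I$, $n\ge1$.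
   Context: $I$ is a segment of the real line; $\mathbf X$ is a real Markov process with all moments finite, infinite support of every $X_t$, and each one-dimensional law determined by its moments; $\mathcal F_{\le s}=\sigma(X_v:v\in I,v\le s)$, $\mathcal F_{s,u}=\sigma(X_v:v\in I,v\notin(s,u))$. $\mu(\cdot,t)$ is the law of $X_t$, $\eta(\cdot,t;y,s)=P(X_t\in\cdot\mid X_s=y)$. $\mathbf X$ is an OPM process if it is an MPR process (for every $n$ and $s\le t$, $E(X_t^n\mid\mathcal F_{\le s})$ is a polynomial of degree at most $n$ in $X_s$, with the non-degeneracy and continuity conditions of the MPR class) and there exist polynomials $p_n(x;t)$ of degree $n$ in $x$, $p_0=1$, with $E p_n(X_t;t)p_m(X_t;t)=\hat p_n(t)\delta_{n,m}$ and $E(p_n(X_t;t)\mid\mathcal F_{\le s})=p_n(X_s;s)$ a.s. for $s\le t$. $\mathbf X$ is a harness if for all $s<t<u$ in $I$, $E(X_t\mid\mathcal F_{s,u})$ is a.s. a polynomial of degree (at most) $1$ in $X_s$ and $X_u$ (with coefficients depending on $s,t,u$). *)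

(* Defs.v *)
From HB Require Import structures.
From mathcomp Require Import all_boot all_order all_algebra.
From mathcomp Require Import all_classical all_reals all_analysis.
Set Implicit Arguments. Unset Strict Implicit. Unset Printing Implicit Defensive.
Import Order.TTheory GRing.Theory Num.Theory.
Import numFieldNormedType.Exports.
Local Open Scope classical_set_scope.
Local Open Scope ring_scope.

Section OPM.
Context (R : realType) (d : measure_display) (T : measurableType d)
  (P : probability T R).

Definition sigma_gen (X : R -> T -> R) (J : set R) : set (set T) :=
  <<s [set A | exists v (B : set R), J v /\ measurable B /\ A = X v @^-1` B] >>.

Definition F_le (I : set R) (X : R -> T -> R) (s : R) : set (set T) :=
  sigma_gen X [set v | I v /\ v <= s].

Definition F_out (I : set R) (X : R -> T -> R) (s u : R) : set (set T) :=
  sigma_gen X [set v | I v /\ ~ (s < v < u)].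

Definition G_measurable (G : set (set T)) (Z : T -> R) :=
  forall B : set R, measurable B -> G (Z @^-1` B).

Definition is_cond_exp (G : set (set T)) (Y Z : T -> R) :=
  [/\ G_measurable G Z, P.-integrable setT (EFin \o Z) &
    forall A, G A -> (\int[P]_(w in A) (Z w)%:E = \int[P]_(w in A) (Y w)%:E)%E].

Definition law (X : R -> T -> R) (t : R) : set R -> \bar R :=
  pushforward P (X t).

Definition support (X : R -> T -> R) (t : R) : set R :=
  [set y | forall e : R, 0 < e -> (0 < law X t (ball y e))%E].

Definition moment_determinate (X : R -> T -> R) (t : R) :=
  forall nu : probability R R,
    (forall n : nat, nu.-integrable setT (fun x => (x ^+ n)%:E) /\
       (\int[nu]_x (x ^+ n)%:E = \int[P]_w ((X t w) ^+ n)%:E)%E) ->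
    forall B : set R, measurable B -> nu B = law X t B.

Definition markov (I : set R) (X : R -> T -> R) :=
  forall s t, I s -> I t -> s <= t -> forall B : set R, measurable B ->
    exists Z : T -> R, G_measurable (sigma_gen X [set s]) Z /\
      is_cond_exp (F_le I X s) (\1_(X t @^-1` B)) Z.

Definition good_markov (I : set R) (X : R -> T -> R) :=
  [/\ forall t, I t -> measurable_fun setT (X t),
      forall t (n : nat), I t -> P.-integrable setT (fun w => ((X t w) ^+ n)%:E),
      forall t, I t -> ~ finite_set (support X t),
      forall t, I t -> moment_determinate X t &
      markov I X].

Definition MPR (I : set R) (X : R -> T -> R) :=
  good_markov I X /\
  exists Q : nat -> R -> R -> {poly R},
    (forall (n : nat) s t, I s -> I t -> s <= t ->
       [/\ (size (Q n s t) <= n.+1)%N,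
           (Q n s t)`_n != 0 &
           is_cond_exp (F_le I X s) (fun w => (X t w) ^+ n)
                       (fun w => (Q n s t).[X s w])]) /\
    (forall n i : nat,
       {within [set st : R * R | [/\ I st.1, I st.2 & st.1 <= st.2]],
          continuous (fun st : R * R => (Q n st.1 st.2)`_i)}).

Definition OPM (I : set R) (X : R -> T -> R) (p : nat -> R -> {poly R}) :=
  [/\ MPR I X,
      forall (n : nat) t, I t -> size (p n t) = n.+1,
      forall t, I t -> p 0%N t = 1,
      exists phat : nat -> R -> R, forall (n m : nat) t, I t ->
        (\int[P]_w ((p n t).[X t w] * (p m t).[X t w])%:E
          = (phat n t * (n == m)%:R)%:E)%E &
      forall (n : nat) s t, I s -> I t -> s <= t ->
        is_cond_exp (F_le I X s) (fun w => (p n t).[X t w])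
                    (fun w => (p n s).[X s w])].

Definition transition_law (I : set R) (X : R -> T -> R)
    (eta : R -> R -> R -> probability R R) :=
  forall s t, I s -> I t -> s < t -> forall B : set R, measurable B ->
    is_cond_exp (sigma_gen X [set s]) (\1_(X t @^-1` B))
                (fun w => fine (eta t (X s w) s B)).

Definition L2_density_condition (I : set R) (X : R -> T -> R)
    (eta : R -> R -> R -> probability R R) :=
  forall s t, I s -> I t -> s < t -> forall y, support X s y ->
    exists g : R -> R, [/\ measurable_fun setT g,
      (law X t).-integrable setT (fun x => ((g x) ^+ 2)%:E) &
      forall B : set R, measurable B ->
        (eta t y s B = \int[law X t]_(x in B) (g x)%:E)%E].

Definition harness (I : set R) (X : R -> T -> R) :=
  forall s t u, I s -> I t -> I u -> s < t -> t < u ->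
    exists c0 c1 c2 : R,
      is_cond_exp (F_out I X s u) (X t) (fun w => c0 + c1 * X s w + c2 * X u w).

End OPM.

(* Main.v *)
(** Write [W = X_t - c0 - c1 X_s - c2 X_u].  Testing the harness property against
    [p_n(X_s) p_m(X_u)] turns it into a linear relation, with the same [c1] and
    [c2] for all [n], between the recurrence coefficients at [s], [t] and [u];
    hence all of them lie in the span of [alpha_1] and [gamma_0], unless
    [gamma_0 / alpha_1 = E p_1(X_t)^2] does not increase, in which case [X_t] is
    almost surely an affine function of [X_s].

    Conversely, the relation between the coefficients gives
    [E(W 1_A p_n(X_u)) = 0] for every [A] in the past of [s] and every [n].  The
    law of [X_u] is determined by its moments, so polynomials are dense in its
    [L2] space (M. Riesz) and [E(W | F_{<=s}, X_u) = 0]; the Markov property then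
    adds the future of [u].

    For the density theorem, let [Z] be orthogonal to the powers of [Y].  If the
    Poisson integral [E(Z b / ((Y - a)^2 + b^2))] were not zero, every polynomial
    majorant [p] of [1/D], [D x = (x - a)^2 + b^2], would satisfy
    [E p(Y) >= E (1/D)(Y) + delta], because [p D - 1] is a sum of two squares.  So
    [p + c/D |-> E p(Y) + c (E (1/D)(Y) + delta)] is positive; its extension by
    Hahn-Banach is represented by a second probability with the moments of [Y]. *)

Require Import Defs.
From HB Require Import structures.
From mathcomp Require Import all_boot all_order all_algebra complex.
From mathcomp Require Import all_classical all_reals all_analysis.
From mathcomp Require Import measurable_realfun ring lra.
Import Order.TTheory GRing.Theory Num.Theory.
Import numFieldNormedType.Exports.
Import HBSimple HBNNSimple.
Local Open Scope classical_set_scope.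
Local Open Scope ring_scope.
Set Implicit Arguments. Unset Strict Implicit. Unset Printing Implicit Defensive.

(** * Sublinear functionals and the Hahn-Banach theorem *)

(** Moment determinacy is a property of the one-dimensional laws, whereas the harness property
    involves the joint law of the past and [X u], for which polynomials need not be dense. So the
    converse keeps the past as an arbitrary event [A]: by the martingale property E(p_k(X_v) 1_A) is
    the same for all v >= s. Polynomials are needed in the single variable [X u] only.

    The [delta] of the density argument is complex analysis in real form. Put z = a + ib; the real
    and imaginary parts of 1/(Y - z) are (Y - a)/D and b/D. If p D - 1 = q1^2 + q2^2, then q1(z)^2 +
    q2(z)^2 = -1, so one of q1 + i q2, q1 - i q2, call it q, has modulus at least 1 at z. Since [Z]
    is orthogonal to polynomials, E(Z q(Y)/(Y - z)) = q(z) E(Z/(Y - z)), and Cauchy-Schwarz bounds E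
    (p - 1/D)(Y) from below by the squared Poisson integral over E Z^2.

    Hahn-Banach yields a functional that is only finitely additive. No mass escapes to infinity,
    because its domain contains all polynomials and is closed under squares. *)

Definition sublinear_on (R : realType) (V : lmodType R) (S : set V)
    (q : V -> R) :=
  (forall x y, S x -> S y -> q (x + y) <= q x + q y) /\
  (forall t x, 0 < t -> S x -> q (t *: x) <= t * q x).

Definition linear_on (R : realType) (V : lmodType R) (S : set V)
    (L : V -> R) :=
  (forall x y, S x -> S y -> L (x + y) = L x + L y) /\
  (forall t x, S x -> L (t *: x) = t * L x).

Definition submodule_on (R : realType) (V : lmodType R) (S : set V) :=
  [/\ S 0, forall x y, S x -> S y -> S (x + y) &
      forall t x, S x -> S (t *: x)].

Section hahn_banach.
Context (R : realType) (V : lmodType R) (S : set V).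
Hypothesis SS : submodule_on S.

Let S0 : S 0. Proof. by case: SS. Qed.
Let SD x y : S x -> S y -> S (x + y). Proof. by case: SS => _ + _; apply. Qed.
Let SZ t x : S x -> S (t *: x). Proof. by case: SS => _ _; apply. Qed.
Let SN x : S x -> S (- x). Proof. by move=> Sx; rewrite -scaleN1r; exact: SZ. Qed.

Lemma sublinear0 (q : V -> R) : sublinear_on S q -> q 0 = 0.
Proof.
move=> [_ qZ].
have h2 : 0 < 2 :> R by [].
have i2 : 0 < 2^-1 :> R by rewrite invr_gt0.
have := qZ 2 0 h2 S0; have := qZ 2^-1 0 i2 S0.
rewrite !scaler0 => H1 H2; apply/eqP; rewrite eq_le; apply/andP; split; lra.
Qed.

Lemma sublinearN (q : V -> R) x : sublinear_on S q -> S x -> - q (- x) <= q x.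
Proof.
move=> qs Sx; have := qs.1 x (- x) Sx (SN Sx).
by rewrite subrr sublinear0// => H; lra.
Qed.

(** For fixed [h], the infimum over t >= 0 of q (y + t h) - t q h is again sublinear and lies below
    [q]. Minimality gives q x <= q' x, and the choice t = 1 turns this into superadditivity. *)
Lemma premaximal_sublinear_linear (q : V -> R) : sublinear_on S q ->
  (forall q', sublinear_on S q' -> (forall x, S x -> q' x <= q x) ->
     forall x, S x -> q x <= q' x) ->
  linear_on S q.
Proof.
move=> qs qmin; have [qD qZ] := qs.
have superadd x h : S x -> S h -> q x + q h <= q (x + h).
  move=> Sx Sh.
  pose E y : set R := [set r | exists2 t, 0 <= t & r = q (y + t *: h) - t * q h].
  have E0 y : E y !=set0 by exists (q (y + 0 *: h) - 0 * q h), 0.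
  have Elb y : S y -> lbound (E y) (- q (- y)).
    move=> Sy _ [t t0 ->].
    have [->|tn0] := eqVneq t 0.
      by rewrite scale0r addr0 mul0r subr0; exact: sublinearN.
    have tp : 0 < t by rewrite lt_def tn0.
    have Sth : S (t *: h) by exact: SZ.
    have := qD (y + t *: h) (- y) (SD Sy Sth) (SN Sy).
    rewrite addrAC subrr add0r => H.
    have : t * q h <= q (t *: h).
      have := qZ t^-1 (t *: h); rewrite invr_gt0 tp scalerA mulVf// scale1r.
      by move=> /(_ isT Sth) H'; rewrite -ler_pdivlMl.
    by move=> H'; lra.
  pose q' y := inf (E y).
  have q'le y t : S y -> 0 <= t -> q' y <= q (y + t *: h) - t * q h.
    move=> Sy t0; apply: ge_inf; first by exists (- q (- y)); exact: Elb.
    by exists t.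
  have q's : sublinear_on S q'.
    split=> [y z Sy Sz|t y t0 Sy].
      rewrite -lerBlDr; apply: lb_le_inf => // _ [t t0 ->].
      rewrite lerBlDr -lerBlDl; apply: lb_le_inf => // _ [s s0 ->].
      rewrite lerBlDr.
      have st0 : 0 <= s + t by exact: addr_ge0.
      have := q'le (y + z) (s + t) (SD Sy Sz) st0.
      have := qD (y + t *: h) (z + s *: h) (SD Sy (SZ _ Sh)) (SD Sz (SZ _ Sh)).
      have -> : y + t *: h + (z + s *: h) = y + z + (s + t) *: h.
        by rewrite addrACA -scalerDl (addrC t).
      by rewrite mulrDl => H1 H2; lra.
    rewrite -ler_pdivrMl//; apply: lb_le_inf => // _ [s s0 ->].
    rewrite ler_pdivrMl//.
    apply: le_trans (q'le (t *: y) (t * s) (SZ _ Sy) (mulr_ge0 (ltW t0) s0)) _.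
    have := qZ t (y + s *: h) t0 (SD Sy (SZ _ Sh)).
    rewrite scalerDr scalerA => H; rewrite mulrBr mulrA; lra.
  have H := qmin q' q's.
  have q'q y : S y -> q' y <= q y.
    by move=> Sy; have := q'le y 0 Sy (lexx _); rewrite scale0r addr0 mul0r subr0.
  have := H q'q x Sx; have := q'le x 1 Sx ler01.
  by rewrite scale1r mul1r => H1 H2; lra.
have qadd x y : S x -> S y -> q (x + y) = q x + q y.
  by move=> Sx Sy; apply/eqP; rewrite eq_le qD//= superadd.
split=> // t x Sx.
have qN y : S y -> q (- y) = - q y.
  move=> Sy; have := qadd y (- y) Sy (SN Sy).
  by rewrite subrr sublinear0// => H; lra.
have qZp s y : 0 < s -> S y -> q (s *: y) = s * q y.
  move=> s0 Sy; apply/eqP; rewrite eq_le qZ//=.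
  have := qZ s^-1 (s *: y); rewrite invr_gt0 s0 scalerA mulVf ?gt_eqF// scale1r.
  by move=> /(_ isT (SZ _ Sy)) H'; rewrite -ler_pdivlMl.
have [t0|t0|->] := ltgtP t 0.
- have -> : t *: x = - ((- t) *: x) by rewrite scaleNr opprK.
  by rewrite qN ?qZp ?oppr_gt0//; [lra|exact: SZ].
- exact: qZp.
- by rewrite scale0r mul0r sublinear0.
Qed.

(** No subspace or partial functional appears: whatever is to be extended gets encoded in [p]. A
    minimal sublinear functional below [p] is linear, and Zorn's lemma supplies one for the reversed
    pointwise order (a preorder, as values off [S] are ignored): chains are bounded by - p (- x), so
    their pointwise infimum is finite. *)
Lemma hahn_banach (p : V -> R) : sublinear_on S p ->
  exists L, linear_on S L /\ forall x, S x -> L x <= p x.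
Proof.
move=> ps.
pose Q := {q : V -> R | sublinear_on S q /\ forall x, S x -> q x <= p x}.
pose le (q1 q2 : Q) : bool := `[< forall x, S x -> sval q2 x <= sval q1 x >].
have p0 : Q by exists p.
have [|||q qmax] := @ZL_preorder Q p0 le.
- by move=> q; apply/asboolP.
- move=> r s t /asboolP sr /asboolP rt; apply/asboolP => x Sx.
  exact: le_trans (rt x Sx) (sr x Sx).
- move=> A tot.
  have [A0|A0] := pselect (A !=set0); last first.
    by exists p0 => s As; exfalso; apply: A0; exists s.
  pose E x : set R := [set r | exists2 q, A q & r = sval q x].
  have E0 x : E x !=set0 by case: A0 => q Aq; exists (sval q x), q.
  have Elb x : S x -> lbound (E x) (- p (- x)).
    move=> Sx _ [q Aq ->]; have [qs qp] := svalP q.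
    apply: le_trans (sublinearN qs Sx); rewrite lerN2.
    by apply: qp; exact: SN.
  have Ele x q : S x -> A q -> inf (E x) <= sval q x.
    move=> Sx Aq; apply: ge_inf; first by exists (- p (- x)); exact: Elb.
    by exists q.
  have infs : sublinear_on S (fun x => inf (E x)).
    split=> [x y Sx Sy|t x t0 Sx].
      rewrite -lerBlDr; apply: lb_le_inf => // _ [q Aq ->].
      rewrite lerBlDr -lerBlDl; apply: lb_le_inf => // _ [r Ar ->].
      rewrite lerBlDr.
      (* Totality of the chain lets a single member of [A] bound both summands. *)
      have [/asboolP qr|/asboolP rq] := tot q r Aq Ar.
        apply: le_trans (Ele (x + y) r (SD Sx Sy) Ar) _.
        apply: le_trans ((svalP r).1.1 x y Sx Sy) _.
        by rewrite addrC lerD2l qr.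
      apply: le_trans (Ele (x + y) q (SD Sx Sy) Aq) _.
      apply: le_trans ((svalP q).1.1 x y Sx Sy) _.
      by rewrite addrC lerD2r rq.
    rewrite -ler_pdivrMl//; apply: lb_le_inf => // _ [q Aq ->].
    rewrite ler_pdivrMl//; apply: le_trans (Ele _ q (SZ _ Sx) Aq) _.
    exact: (svalP q).1.2.
  have infp : forall x, S x -> inf (E x) <= p x.
    move=> x Sx; case: A0 => q Aq; apply: le_trans (Ele x q Sx Aq) _.
    exact: (svalP q).2.
  pose infq : Q := exist _ (fun x => inf (E x)) (conj infs infp).
  exists infq => s As.
  by apply/asboolP => x Sx; exact: Ele.
exists (sval q); split; last exact: (svalP q).2.
apply: premaximal_sublinear_linear; first exact: (svalP q).1.
move=> q' q's q'q x Sx.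
have q'p : forall x, S x -> q' x <= p x.
  by move=> y Sy; apply: le_trans (q'q y Sy) ((svalP q).2 y Sy).
pose Q' : Q := exist _ q' (conj q's q'p).
have /qmax/asboolP : le q Q' by apply/asboolP.
exact.
Qed.

End hahn_banach.

(** * Nonnegative polynomials *)

Section nonnegative_polynomials.
Local Open Scope complex_scope.

(** Right continuity in algebraic form, valid in any real closed field: the quotient of p - p(r) by
    X - r is bounded near [r], so a negative value at [r] would persist at a small explicit
    distance. *)
Lemma poly_ge0_right (R : rcfType) (p : {poly R}) (r : R) :
  (forall h, 0 < h -> 0 <= p.[r + h]) -> 0 <= p.[r].
Proof.
move=> p0; set c : R := p.[r].
have [p1 pE] : exists p1, p = p1 * ('X - r%:P) + c%:P.
  have /factor_theorem[p1 E] : root (p - c%:P) r.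
    by rewrite rootE !hornerE subrr.
  by exists p1; rewrite -E subrK.
have [M pM] : {M : R | forall x, r - 1 <= x <= r + 1 -> `|p1.[x]| <= M}.
  exact: poly_itv_bound.
have M0 : 0 <= M by apply: le_trans (pM r _); [exact: normr_ge0|lra].
rewrite leNgt; apply/negP => c0.
(* Small enough that d < 1, where the bound [M] applies, and that d M < - c, which makes p (r + d)
   negative. *)
pose d : R := - c / (- c + M + 1).
have Kp : 0 < - c + M + 1 by lra.
have d0 : 0 < d by rewrite divr_gt0// oppr_gt0.
have d1 : d < 1 by rewrite ltr_pdivrMr//; lra.
have dM : d * M < - c.
  by rewrite /d mulrAC ltr_pdivrMr// ltr_pM2l ?oppr_gt0//; lra.
have := p0 d d0; rewrite pE !hornerE.
have -> : r + d - r = d by ring.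
have : p1.[r + d] <= M by apply: le_trans (ler_norm _) (pM _ _); lra.
by set w : R := p1.[_]; nra.
Qed.

(** The cofactor of X - r is nonnegative to the right of [r] and nonpositive to the left; the two
    one-sided limits force it to vanish at [r]. *)
Lemma nonneg_poly_double_root (R : rcfType) (q : {poly R}) (r : R) :
  (forall x, 0 <= q.[x]) -> root q r -> exists q', q = q' * ('X - r%:P) ^+ 2.
Proof.
move=> q0 /factor_theorem[p qE].
suff /factor_theorem[p' pE] : root p r.
  by exists p'; rewrite qE pE expr2 mulrA.
have qx (h : R) : 0 <= p.[r + h] * h.
  have := q0 (r + h); rewrite qE !hornerE.
  by have -> : r + h - r = h by ring.
rewrite rootE eq_le; apply/andP; split.
  have := @poly_ge0_right _ (- (p \Po (- 'X))) (- r).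
  rewrite !hornerE horner_comp !hornerE opprK oppr_ge0; apply => h h0.
  rewrite !hornerE horner_comp !hornerE opprD opprK oppr_ge0.
  by have := qx (- h); rewrite mulrN oppr_ge0 pmulr_lle0.
by apply: poly_ge0_right => h h0; have := qx h; rewrite pmulr_lge0.
Qed.

(** Sums of two squares are closed under products, so it suffices to split off a factor (X - a)^2 +
    b^2 given by a complex root a + ib and to induct on the size. A real root (b = 0) is double, so
    it gives a factor of the same form. *)
Lemma nonneg_poly_sum_two_squares (R : rcfType) (q : {poly R}) :
  (forall x, 0 <= q.[x]) -> exists u v : {poly R}, q = u ^+ 2 + v ^+ 2.
Proof.
move: {2}(size q) (leqnn (size q)) => n.
elim: n q => [|m IH] q qn q0.
  exists 0, 0; have : size q == 0%N by rewrite -leqn0.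
  by rewrite size_poly_eq0 => /eqP->; rewrite expr0n addr0.
have [s1|s1] := leqP (size q) 1.
  have /size1_polyC qE := s1.
  have c0 : 0 <= q`_0 by have := q0 0; rewrite {1}qE hornerC.
  exists (Num.sqrt q`_0)%:P, 0.
  by rewrite expr0n addr0 -polyC_exp sqr_sqrtr.
have qn0 : q != 0 by rewrite -size_poly_gt0 (ltn_trans _ s1).
pose f := real_complex R.
have /closed_rootP[[a b] zr] : size (map_poly f q) != 1%N.
  by rewrite size_map_poly gtn_eqF.
have key : exists k, q = k * (('X - a%:P) ^+ 2 + (b ^+ 2)%:P).
  have [b0|b0] := eqVneq b 0.
    have [k kE] : exists k, q = k * ('X - a%:P) ^+ 2.
      apply: nonneg_poly_double_root => //.
      by move: zr; rewrite b0 -[a +i* 0]/(f a) fmorph_root.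
    by exists k; rewrite b0 expr0n addr0.
  set D := ('X - a%:P) ^+ 2 + (b ^+ 2)%:P.
  have sD : size D = 3%N.
    by rewrite size_addl ?size_exp_XsubC// ltnS (leq_trans (size_polyC_leq1 _)).
  have D0 : D != 0 by rewrite -size_poly_gt0 sD.
  have := divp_eq q D; set k := q %/ D; set r := q %% D => qE.
  have sr : (size r <= 2)%N by rewrite -ltnS -sD ltn_modp.
  have rE : r = (r`_1)%:P * 'X + (r`_0)%:P.
    apply/polyP => i; rewrite coefD coefMX !coefC.
    case: i => [|[|i]] /=; rewrite ?add0r ?addr0//.
    by rewrite nth_default ?addr0// (leq_trans sr).
  have : (map_poly f r).[a +i* b] = 0.
    have /rootP := zr; rewrite qE rmorphD rmorphM/= hornerD hornerM.
    have -> : (map_poly f D).[a +i* b] = 0.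
      rewrite /D rmorphD rmorphXn rmorphB/= map_polyX !map_polyC/= !hornerE.
      by apply/eqP; rewrite eq_complex expr2 /= !subrr; apply/andP; split; apply/eqP; ring.
    by rewrite mulr0 add0r.
  rewrite rE rmorphD rmorphM/= map_polyX !map_polyC/= !hornerE.
  move=> /eqP; rewrite eq_complex /= => /andP[/eqP H1 /eqP H2].
  have r1 : r`_1 = 0.
    apply/eqP; have : r`_1 * b == 0 by apply/eqP; rewrite -[RHS]H2; ring.
    by rewrite mulf_eq0 (negbTE b0) orbF.
  have r0 : r`_0 = 0 by move: H1; rewrite r1 !mul0r subr0 add0r.
  by exists k; rewrite [LHS]qE rE r1 r0 mul0r !addr0.
have [k kE] := key.
pose D := ('X - a%:P) ^+ 2 + (b ^+ 2)%:P.
have sD : size D = 3%N.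
  by rewrite size_addl ?size_exp_XsubC// ltnS (leq_trans (size_polyC_leq1 _)).
have k0 : k != 0 by apply: contraNneq qn0 => k0; rewrite kE k0 mul0r.
have D0 : D != 0 by rewrite -size_poly_gt0 sD.
have [||u [v kuv]] := IH k.
- have : (size q <= m.+1)%N by [].
  rewrite kE size_mul// sD; move: k0; rewrite -size_poly_gt0 addn3 /= ltnS => k0.
  by apply: leq_trans; exact: leqnSn.
- have kD y : y != a -> 0 <= k.[y].
    move=> ya; have := q0 y; rewrite kE !hornerE pmulr_lge0//.
    rewrite ltr_wpDr ?sqr_ge0// lt_def sqr_ge0 andbT sqrf_eq0 subr_eq0.
    exact: ya.
  move=> x; have [->|/kD//] := eqVneq x a.
  by apply: poly_ge0_right => h h0; apply: kD; rewrite gt_eqF// ltrDl.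
(* Brahmagupta's identity: these are the real and imaginary parts of (u + iv)((X - a) + ib). *)
exists (u * ('X - a%:P) - v * b%:P), (u * b%:P + v * ('X - a%:P)).
rewrite kE kuv polyC_exp; ring.
Qed.

End nonnegative_polynomials.

(** * Square integrable random variables *)

Section expectation.
Context (R : realType) (d : measure_display) (T : measurableType d)
  (P : probability T R).
Implicit Types (f g : T -> R) (A : set T).

Definition L1 f := P.-integrable setT (EFin \o f).
(** Real-valued even when [f] is not integrable, where the value carries no information; hence the
    [L1] premises of the linearity lemmas. *)
Definition Ex f : R := \int[P]_w f w.
Definition L2 f := measurable_fun setT f /\ L1 (fun w => f w ^+ 2).

Lemma L1_measurable f : L1 f -> measurable_fun setT f.
Proof. by move=> /measurable_int /measurable_EFinP. Qed.

Lemma L1_le f g : measurable_fun setT f -> (forall w, `|f w| <= g w) ->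
  L1 g -> L1 f.
Proof.
move=> mf fg; apply: le_integrable => //; first exact/measurable_EFinP.
by move=> w _; rewrite /= lee_fin (le_trans (fg w))// ler_norm.
Qed.

Lemma L1D f g : L1 f -> L1 g -> L1 (fun w => f w + g w).
Proof. by move=> f1 g1; exact: (integrableD measurableT f1 g1). Qed.

Lemma L1B f g : L1 f -> L1 g -> L1 (fun w => f w - g w).
Proof. by move=> f1 g1; exact: (integrableB measurableT f1 g1). Qed.

Lemma L1Z k f : L1 f -> L1 (fun w => k * f w).
Proof. by move=> f1; exact: (integrableZl measurableT k f1). Qed.

Lemma L1_cst k : L1 (fun=> k).
Proof. exact: finite_measure_integrable_cst. Qed.

Lemma L1_bounded f k : measurable_fun setT f -> (forall w, `|f w| <= k) -> L1 f.
Proof. by move=> mf fk; apply: L1_le mf fk (L1_cst k). Qed.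

Lemma L1M f k g : measurable_fun setT g -> (forall w, `|g w| <= k) -> L1 f ->
  L1 (fun w => f w * g w).
Proof.
move=> mg gk f1; apply: (@L1_le _ (fun w => k * `|f w|)).
- exact: measurable_funM (L1_measurable f1) mg.
- by move=> w; rewrite normrM mulrC ler_wpM2r.
- by apply: L1Z; exact: integrable_norm.
Qed.

Lemma indic_le1 A w : `|\1_A w : R| <= 1.
Proof. by rewrite indicE; case: (_ \in _); rewrite ?normr1// normr0. Qed.

Lemma L1_indic f A : measurable A -> L1 f -> L1 (fun w => f w * \1_A w).
Proof.
move=> mA; apply: (@L1M _ 1); first exact: measurable_indic.
by move=> w; exact: indic_le1.
Qed.

Lemma ExD f g : L1 f -> L1 g -> Ex (fun w => f w + g w) = Ex f + Ex g.
Proof. by move=> f1 g1; rewrite /Ex RintegralD. Qed.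

Lemma ExB f g : L1 f -> L1 g -> Ex (fun w => f w - g w) = Ex f - Ex g.
Proof. by move=> f1 g1; rewrite /Ex RintegralB. Qed.

Lemma ExZ k f : L1 f -> Ex (fun w => k * f w) = k * Ex f.
Proof. by move=> f1; rewrite /Ex RintegralZl. Qed.

Lemma Ex_cst k : Ex (fun=> k) = k.
Proof.
rewrite /Ex /Rintegral integral_cst//.
by rewrite [X in (_ * X)%E]probability_setT mule1.
Qed.

Lemma Ex_le f g : L1 f -> L1 g -> (forall w, f w <= g w) -> Ex f <= Ex g.
Proof. by move=> f1 g1 fg; apply: le_Rintegral. Qed.

Lemma Ex_ge0 f : (forall w, 0 <= f w) -> 0 <= Ex f.
Proof. by move=> f0; apply: Rintegral_ge0. Qed.

Lemma integral_Ex f : L1 f -> (\int[P]_w (f w)%:E = (Ex f)%:E)%E.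
Proof. by move=> f1; rewrite /Ex /Rintegral fineK//; exact: integrable_fin_num. Qed.

Lemma integral_indic_Ex f A : measurable A -> L1 f ->
  (\int[P]_(w in A) (f w)%:E = (Ex (fun w => f w * \1_A w))%:E)%E.
Proof.
move=> mA f1; rewrite -integral_Ex; last exact: L1_indic.
rewrite integral_mkcond; apply: eq_integral => w _; rewrite patchE indicE.
by case: ifPn; rewrite ?mulr1 ?mulr0.
Qed.

Lemma L1_sum (I : Type) (r : seq I) (F : I -> T -> R) :
  (forall i, L1 (F i)) -> L1 (fun w => \sum_(i <- r) F i w).
Proof.
move=> F1; elim: r => [|i r IH].
  by under eq_fun do rewrite big_nil; exact: L1_cst.
by under eq_fun do rewrite big_cons; exact: L1D.
Qed.

Lemma Ex_sum (I : Type) (r : seq I) (F : I -> T -> R) :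
  (forall i, L1 (F i)) ->
  Ex (fun w => \sum_(i <- r) F i w) = \sum_(i <- r) Ex (F i).
Proof.
move=> F1; elim: r => [|i r IH].
  by rewrite big_nil; under eq_fun do rewrite big_nil; exact: Ex_cst.
rewrite big_cons -IH -ExD//; last exact: L1_sum.
by under eq_fun do rewrite big_cons.
Qed.

Lemma L2M f g : L2 f -> L2 g -> L1 (fun w => f w * g w).
Proof.
move=> [mf f2] [mg g2].
apply: (@L1_le _ (fun w => f w ^+ 2 + g w ^+ 2)); last exact: L1D.
  exact: measurable_funM.
move=> w; rewrite normrM -(real_normK (num_real (f w))).
rewrite -(real_normK (num_real (g w))).
have := normr_ge0 (f w); have := normr_ge0 (g w); nra.
Qed.

Lemma L2_cst k : L2 (fun=> k).
Proof. by split=> //; exact: L1_cst. Qed.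

Lemma L2_L1 f : L2 f -> L1 f.
Proof.
by move=> f2; have := L2M f2 (L2_cst 1); under eq_fun do rewrite mulr1.
Qed.

Lemma L2Z k f : L2 f -> L2 (fun w => k * f w).
Proof.
move=> [mf f2]; split; first exact: measurable_funM.
by under eq_fun do rewrite exprMn; exact: L1Z.
Qed.

Lemma L2D f g : L2 f -> L2 g -> L2 (fun w => f w + g w).
Proof.
move=> f2 g2; split; first exact: measurable_funD f2.1 g2.1.
under eq_fun => w do rewrite sqrrD -mulr_natl.
by apply: L1D g2.2; apply: L1D f2.2 _; apply: L1Z; exact: L2M.
Qed.

Lemma L2B f g : L2 f -> L2 g -> L2 (fun w => f w - g w).
Proof.
move=> f2 g2; have := L2D f2 (L2Z (-1) g2).
by under eq_fun => w do rewrite mulN1r.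
Qed.

Lemma L2_indic f A : measurable A -> L2 f -> L2 (fun w => f w * \1_A w).
Proof.
move=> mA [mf f2]; split.
  by apply: measurable_funM => //; exact: measurable_indic.
have := L1_indic mA f2; congr L1; apply/funext => w.
by rewrite exprMn; congr (_ * _); rewrite indicE; case: (_ \in _); rewrite ?expr1n ?expr0n.
Qed.

Lemma Ex_cauchy_schwarz f g : L2 f -> L2 g ->
  Ex (fun w => f w * g w) ^+ 2 <=
    Ex (fun w => f w ^+ 2) * Ex (fun w => g w ^+ 2).
Proof.
move=> f2 g2; set a := Ex (fun w => f w ^+ 2); set b := Ex (fun w => f w * g w).
set c := Ex (fun w => g w ^+ 2).
have fg1 := L2M f2 g2.
have key s : 0 <= a + s * (2 * b) + s ^+ 2 * c.
  have -> : a + s * (2 * b) + s ^+ 2 * c = Ex (fun w => (f w + s * g w) ^+ 2).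
    rewrite /a /b /c -!ExZ//; [|exact: g2.2|exact: L1Z].
    rewrite -ExD; [|exact: f2.2|by do 2 apply: L1Z].
    rewrite -ExD; first last.
    - by apply: L1Z; exact: g2.2.
    - by apply: L1D; [exact: f2.2|do 2 apply: L1Z].
    - by congr Ex; apply/funext => w; ring.
  by apply: Ex_ge0 => w; exact: sqr_ge0.
have c0 : 0 <= c by apply: Ex_ge0 => w; exact: sqr_ge0.
have a0 : 0 <= a by apply: Ex_ge0 => w; exact: sqr_ge0.
have [c0'|cn0] := eqVneq c 0.
  have [->|b0] := eqVneq b 0; first by rewrite expr0n mulr_ge0.
  (* For c = 0 the quadratic is affine in [s], and this [s] gives it the value -1. *)
  have := key (- (a + 1) / (2 * b)).
  have -> : - (a + 1) / (2 * b) * (2 * b) = - (a + 1).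
    by rewrite divfK// mulf_neq0.
  by rewrite c0' mulr0 addr0; lra.
have := key (- b / c).
have -> : a + - b / c * (2 * b) + (- b / c) ^+ 2 * c = a - b ^+ 2 / c by field.
by rewrite subr_ge0 ler_pdivrMr// lt_def cn0.
Qed.

Lemma Ex_dominated (f_ : nat -> T -> R) f g :
  (forall n, measurable_fun setT (f_ n)) ->
  (forall w, f_ n w @[n --> \oo] --> f w) ->
  (forall n w, `|f_ n w| <= g w) -> L1 g ->
  L1 f /\ (Ex (f_ n) @[n --> \oo] --> Ex f).
Proof.
move=> mf_ f_f fg g1.
have mf : measurable_fun setT f.
  by apply: (@measurable_fun_cvg _ _ _ setT f_ f) => // w _; exact: f_f.
have f_1 n : L1 (f_ n) by apply: L1_le (mf_ n) (fg n) g1.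
have [|||H1 _ H2] := @dominated_convergence _ _ R P setT measurableT
  (fun n w => (f_ n w)%:E) (EFin \o f) (EFin \o g)
  (fun n => (measurable_EFinP _ _).2 (mf_ n)) ((measurable_EFinP _ _).2 mf).
- apply: aeW => w _; apply/cvg_EFin; first exact: nearW.
  exact: f_f.
- exact: g1.
- by apply: aeW => w n _; exact: fg.
split; first exact: H1.
apply/fine_cvg; rewrite -(integral_Ex H1).
exact: H2.
Qed.

(* Only the law of [xi] matters: approximate the identity of [R] by simple
   functions and compose with [xi]. *)
Lemma Ex_pull_out (V xi : T -> R) : L1 V -> measurable_fun setT xi ->
  (forall B, measurable B -> Ex (fun w => V w * \1_(xi @^-1` B) w) = 0) ->
  L1 (fun w => V w * xi w) -> Ex (fun w => V w * xi w) = 0.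
Proof.
move=> V1 mxi V0 Vxi.
have mV := L1_measurable V1.
have pull (phi : R -> R) : measurable_fun setT phi -> (forall x, 0 <= phi x) ->
    L1 (fun w => V w * phi (xi w)) -> Ex (fun w => V w * phi (xi w)) = 0.
  move=> mphi phi0 Vphi.
  have [g [gnd gcvg]] := @approximation _ _ R setT measurableT (EFin \o phi)
    ((measurable_EFinP _ _).2 mphi) (fun x _ => phi0 x).
  have mB n y : measurable (xi @^-1` (g n @^-1` [set y])).
    by rewrite -[X in measurable X]setTI; apply: mxi.
  have Vg n : Ex (fun w => V w * g n (xi w)) = 0.
    have -> : (fun w => V w * g n (xi w)) =
        (fun w => \sum_(y <- finmap.enum_fset (fset_set (range (g n))))
           y * (V w * \1_(xi @^-1` (g n @^-1` [set y])) w)).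
      apply/funext => w; rewrite [in LHS](fimfunE (g n)).
      rewrite fsbig_finite//= mulr_sumr.
      by apply: eq_bigr => y _; rewrite mulrCA.
    have L y : L1 (fun w => V w * \1_(xi @^-1` (g n @^-1` [set y])) w).
      exact: L1_indic.
    rewrite Ex_sum; last by move=> y; apply: L1Z; exact: L.
    apply: big1 => y _; rewrite ExZ; last exact: L.
    by rewrite V0 ?mulr0//; exact: measurable_sfunP.
  have glim x : g n x @[n --> \oo] --> phi x.
    exact: (fine_cvg (gcvg x I)).
  have gle n x : `|g n x| <= phi x.
    rewrite ger0_norm// -(cvg_lim (@Rhausdorff R) (glim x)).
    apply: nondecreasing_cvgn_le; last by apply/cvg_ex; exists (phi x).
    by move=> a b ab; exact/lefP/gnd.
  have [||||_] := @Ex_dominated (fun n w => V w * g n (xi w))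
    (fun w => V w * phi (xi w)) (fun w => `|V w * phi (xi w)|).
  - move=> n; apply: measurable_funM => //; exact: measurableT_comp.
  - by move=> w; apply: cvgMr; exact: glim.
  - by move=> n w; rewrite !normrM ler_wpM2l// (le_trans (gle n _))// ler_norm.
  - exact: integrable_norm.
  under eq_fun do rewrite Vg.
  by move=> /cvg_lim <-//; rewrite lim_cst.
pose phi1 (x : R) := Num.max x 0; pose phi2 (x : R) := Num.max (- x) 0.
have E x : x = phi1 x - phi2 x.
  rewrite /phi1 /phi2; case: (lerP x 0) => h; case: (lerP (- x) 0) => h'; lra.
have m1 : measurable_fun setT phi1 by exact: measurable_maxr.
have m2 : measurable_fun setT phi2 by apply: measurable_maxr => //; exact: measurable_funN.
have p1 x : 0 <= phi1 x by rewrite le_max lexx orbT.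
have p2 x : 0 <= phi2 x by rewrite le_max lexx orbT.
have b1 x : `|phi1 x| <= `|x|.
  by rewrite ger0_norm// ge_max ler_norm normr_ge0.
have b2 x : `|phi2 x| <= `|x|.
  by rewrite ger0_norm// ge_max normr_ge0 andbT -normrN ler_norm.
have L (phi : R -> R) : measurable_fun setT phi -> (forall x, `|phi x| <= `|x|) ->
    L1 (fun w => V w * phi (xi w)).
  move=> mphi bphi; apply: (@L1_le _ (fun w => `|V w * xi w|)).
  - by apply: measurable_funM => //; exact: measurableT_comp.
  - by move=> w; rewrite !normrM ler_wpM2l.
  - exact: integrable_norm.
have -> : (fun w => V w * xi w) = (fun w => V w * phi1 (xi w) - V w * phi2 (xi w)).
  by apply/funext => w; rewrite -mulrBr -E.
by rewrite ExB ?L// !pull ?subrr//; exact: L.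
Qed.

End expectation.

(** * Positive functionals on polynomials *)

(** The space on which Hahn-Banach is applied. It contains the polynomials, 1/D and the step
    functions, and each member has polynomial bounds on both sides, which keeps the infimum over
    majorants finite. *)
Definition polydom (R : realType) (h : R -> R) :=
  exists p : {poly R}, forall x, `|h x| <= p.[x].

Section polydom.
Context (R : realType).
Implicit Types (f g h : R -> R).

Lemma polydom_poly (p : {poly R}) : polydom (horner p).
Proof.
exists ('X * 0 + (p ^+ 2 + 1)) => x; rewrite !hornerE.
by rewrite ler_norml; apply/andP; split; nra.
Qed.

Lemma polydom_bounded f k : (forall x, `|f x| <= k) -> polydom f.
Proof. by move=> fk; exists k%:P => x; rewrite hornerC. Qed.

Lemma polydomD f g : polydom f -> polydom g -> polydom (fun x => f x + g x).
Proof.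
move=> [p fp] [q gq]; exists (p + q) => x; rewrite hornerD.
by apply: le_trans (ler_normD _ _) _; exact: lerD.
Qed.

Lemma polydomM f g : polydom f -> polydom g -> polydom (fun x => f x * g x).
Proof.
move=> [p fp] [q gq]; exists (p * q) => x; rewrite hornerM normrM.
exact: ler_pM.
Qed.

Lemma polydom_cst (k : R) : polydom (fun=> k).
Proof. exact: polydom_bounded. Qed.

Lemma polydomZ k f : polydom f -> polydom (fun x => k * f x).
Proof. by move=> pf; apply: polydomM => //; exact: polydom_cst. Qed.

Lemma polydomN f : polydom f -> polydom (fun x => - f x).
Proof. by move=> [p fp]; exists p => x; rewrite normrN. Qed.

Lemma polydom_norm f : polydom f -> polydom (fun x => `|f x|).
Proof. by move=> [p fp]; exists p => x; rewrite normr_id. Qed.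

Lemma polydom_submodule : @submodule_on R (R -> R^o) (@polydom R).
Proof.
split; first exact: polydom_cst; first exact: polydomD.
by move=> t h; exact: polydomZ.
Qed.

End polydom.

(** * Extension of a positive functional on polynomials *)

Definition linear_functional (R : realType) (L : (R -> R) -> R) :=
  (forall f g, polydom f -> polydom g ->
     L (fun x => f x + g x) = L f + L g) /\
  (forall t f, polydom f -> L (fun x => t * f x) = t * L f).

Section extension.
Context (R : realType).

(** M. Riesz extension. The sublinear functional sends [h] to the infimum of l p + c tau over all
    majorants p + c f of [h]. A functional below it is positive, since 0 is a majorant of - h when h
    >= 0; and it takes the prescribed values, since p + c f and its negative are their own
    majorants. *)
Lemma positive_extension (l : {poly R} -> R) (f : R -> R) (tau : R) :
  (forall p q, l (p + q) = l p + l q) -> (forall t p, l (t *: p) = t * l p) ->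
  polydom f ->
  (forall p c, (forall x, 0 <= p.[x] + c * f x) -> 0 <= l p + c * tau) ->
  exists L : (R -> R) -> R, [/\ linear_functional L,
    forall h, polydom h -> (forall x, 0 <= h x) -> 0 <= L h &
    forall p c, L (fun x => p.[x] + c * f x) = l p + c * tau].
Proof.
move=> lD lZ pf l0.
pose E (h : R -> R) : set R := [set r | exists p c,
  (forall x, h x <= p.[x] + c * f x) /\ r = l p + c * tau].
have E0 h : polydom h -> E h !=set0.
  move=> [p hp]; exists (l p + 0 * tau), p, 0; split=> // x.
  by rewrite mul0r addr0 (le_trans (ler_norm _)).
have Elb h p : (forall x, `|h x| <= p.[x]) -> lbound (E h) (- l p).
  move=> hp _ [q [c [hq ->]]].
  have : 0 <= l (p + q) + c * tau.
    apply: l0 => x; rewrite hornerD; have := hp x; have := hq x.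
    by rewrite ler_norml => H1 /andP[H2 _]; lra.
  by rewrite lD; lra.
have Ele h p c : polydom h -> (forall x, h x <= p.[x] + c * f x) ->
    inf (E h) <= l p + c * tau.
  move=> [q hq] hp; apply: ge_inf; last by exists p, c.
  by exists (- l q); exact: Elb.
pose sub h := inf (E h).
have ssub : @sublinear_on R (R -> R^o) (@polydom R) sub.
  split=> [g h pg ph|t h t0 ph].
    rewrite -lerBlDr; apply: lb_le_inf => [|_ [p [c [gp ->]]]]; first exact: E0.
    rewrite lerBlDr -lerBlDl; apply: lb_le_inf => [|_ [q [e [hq ->]]]].
      exact: E0.
    rewrite lerBlDl.
    have -> : l p + c * tau + (l q + e * tau) = l (p + q) + (c + e) * tau.
      by rewrite lD; ring.
    apply: Ele; first exact: polydomD.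
    by move=> x; rewrite hornerD mulrDl addrACA; exact: lerD.
  rewrite -ler_pdivrMl//; apply: lb_le_inf => [|_ [p [c [gp ->]]]].
    exact: E0.
  rewrite ler_pdivrMl//.
  have -> : t * (l p + c * tau) = l (t *: p) + (t * c) * tau by rewrite lZ; ring.
  apply: Ele; first exact: polydomZ.
  move=> x; rewrite hornerZ -mulrA -mulrDr.
  by rewrite /GRing.scale/= ler_pM2l.
have [L [Llin' Lsub]] := hahn_banach (@polydom_submodule R) ssub.
have Llin : linear_functional L by exact: Llin'.
have LN h : polydom h -> L (fun x => - h x) = - L h.
  move=> ph; have := Llin.2 (-1) h ph; rewrite mulN1r => <-; congr L.
  by apply/funext => x; rewrite mulN1r.
have Lle h p c : polydom h -> (forall x, h x <= p.[x] + c * f x) ->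
    L h <= l p + c * tau.
  by move=> ph hp; apply: le_trans (Lsub _ ph) _; exact: Ele.
have ldom p c : polydom (fun x => p.[x] + c * f x).
  by apply: polydomD; [exact: polydom_poly|exact: polydomZ].
have l00 : l 0 = 0 by have := lZ 0 0; rewrite scale0r mul0r.
exists L; split => //.
- move=> h ph h0; have := Lle _ 0 0 (polydomN ph).
  rewrite l00 mul0r addr0 LN// oppr_le0; apply=> x.
  by rewrite horner0 mul0r addr0 oppr_le0.
- move=> p c; apply/eqP; rewrite eq_le Lle//=.
  have := Lle _ (- p) (- c) (polydomN (ldom p c)).
  rewrite LN// => H; have : - L (fun x => p.[x] + c * f x) <= l (- p) + - c * tau.
    by apply: H => x; rewrite hornerN; lra.
  by have := lZ (-1) p; rewrite scaleN1r => ->; lra.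
Qed.

End extension.

(** * Step functions, distribution functions, uniform continuity *)

Definition step (R : realType) (a x : R) : R := (x <= a)%R%:R.

Section step.
Context (R : realType).
Implicit Types a b x : R.

Lemma step1 a x : x <= a -> step a x = 1.
Proof. by rewrite /step => ->. Qed.

Lemma step0 a x : a < x -> step a x = 0.
Proof. by rewrite /step leNgt => ->. Qed.

Lemma step_ge0 a x : 0 <= step a x. Proof. exact: ler0n. Qed.

Lemma step_le1 a x : step a x <= 1.
Proof. by case: (leP x a) => xa; [rewrite step1|rewrite step0]. Qed.

Lemma step_le a b x : a <= b -> step a x <= step b x.
Proof.
move=> ab; case: (leP x a) => xa; last by rewrite (step0 xa) step_ge0.
by rewrite !step1// (le_trans xa ab).
Qed.

Lemma step_indic a : step a = \1_`]-oo, a]%classic.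
Proof.
apply/funext => x; rewrite indicE /step; congr (_%:R); congr nat_of_bool.
by apply/idP/idP; rewrite inE/= in_itv.
Qed.

Lemma polydom_step a : polydom (step a).
Proof.
apply: (@polydom_bounded _ _ 1) => x; rewrite ger0_norm ?step_ge0//.
exact: step_le1.
Qed.

End step.

Lemma probability_of_cdf (R : realType) (G : R -> R) :
  {homo G : x y / x <= y} -> (forall x, G @ at_right x --> G x) ->
  G @ -oo --> (0 : R) -> G @ +oo --> (1 : R) ->
  exists nu : probability R R, forall a, nu `]-oo, a]%classic = (G a)%:E.
Proof.
move=> nd rc G0 G1.
pose Gc : cumulativeBounded (0:R) (1:R) := HB.pack G
  (isCumulative.Build R _ R G nd rc) (isCumulativeBounded.Build R 0 1 G G0 G1).
pose nu0 : probability (measurableTypeR R) R := lebesgue_stieltjes_measure Gc.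
(* The Lebesgue-Stieltjes measure lives on [measurableTypeR R]; pushing it forward along the
   identity moves it to [R]. *)
pose idR : measurableTypeR R -> R := idfun.
pose X : {RV nu0 >-> R} :=
  HB.pack idR (@isMeasurableFun.Build _ _ _ _ idR (@measurable_id _ _ setT)).
exists (distribution nu0 X) => a.
exact: cdf_lebesgue_stieltjes_id Gc a.
Qed.

(** Only [x] is confined to [a, b]. The point [y] may leave the interval, as it does when the nodes
    of a partition are shifted to the right. *)
Lemma heine_cantor (R : realType) (f : R -> R) (a b e : R) : continuous f ->
  0 < e -> exists2 d : R, 0 < d &
  forall x y, a <= x -> x <= b -> `|x - y| < d -> `|f x - f y| < e.
Proof.
move=> cf e0.
have /compact_near_coveringP := @segment_compact R a b.
move=> /(_ R (0 : R)^'+ (fun d x => forall y, `|x - y| < d -> `|f x - f y| < e)).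
move=> /(_ _ _)[].
  move=> x _.
  have /cvgrPdist_lt/(_ (e / 2)) := cf x.
  rewrite divr_gt0// => /(_ isT)/nbhs_ballP[r /= r0 xr].
  exists (ball x (r / 2), [set d | d < r / 2]) => /=.
    split; first by apply: nbhsx_ballx; rewrite divr_gt0.
    by apply: nbhs_right_lt; rewrite divr_gt0.
  move=> [x' d] /= [xx' dr] y x'y.
  have H1 : `|f x - f x'| < e / 2.
    by apply: xr; apply: lt_trans xx' _; rewrite ltr_pdivrMr// ltr_pMr// ltr1n.
  have H2 : `|f x - f y| < e / 2.
    apply: xr; rewrite /ball/= -(subrKA x'); apply: le_lt_trans (ler_normD _ _) _.
    by have := xx'; rewrite /ball/= => xx''; lra.
  rewrite -(subrKA (f x)); apply: le_lt_trans (ler_normD _ _) _.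
  by rewrite (distrC (f x')); lra.
move=> d /= d0 H; exists (d / 2); first by rewrite divr_gt0.
move=> x y ax xb; apply: (H (d / 2)) => //=.
- by rewrite sub0r normrN gtr0_norm ?divr_gt0// ltr_pdivrMr// ltr_pMr// ltr1n.
- by rewrite divr_gt0.
- by rewrite in_itv/= ax.
Qed.

(** * Integral representation of a positive functional *)

Section representation.
Context (R : realType) (L : (R -> R) -> R).
Hypothesis Llin : linear_functional L.
Hypothesis Lpos : forall h, polydom h -> (forall x, 0 <= h x) -> 0 <= L h.
Hypothesis Lunit : L (fun=> 1) = 1.

Let LD f g : polydom f -> polydom g -> L (fun x => f x + g x) = L f + L g.
Proof. exact: Llin.1. Qed.

Let LZ k f : polydom f -> L (fun x => k * f x) = k * L f.
Proof. exact: Llin.2. Qed.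

Let Lcst k : L (fun=> k) = k.
Proof.
have H := LZ k (@polydom_cst R 1); rewrite Lunit mulr1 in H.
by rewrite -[RHS]H; congr L; apply/funext => x; rewrite mulr1.
Qed.

Let LB f g : polydom f -> polydom g -> L (fun x => f x - g x) = L f - L g.
Proof.
move=> pf pg; rewrite LD//; last exact: polydomN.
congr (_ + _); rewrite -mulN1r -LZ//; congr L; apply/funext => x.
by rewrite mulN1r.
Qed.

Let Lle f g : polydom f -> polydom g -> (forall x, f x <= g x) -> L f <= L g.
Proof.
move=> pf pg fg; rewrite -subr_ge0 -LB//; apply: Lpos => [|x].
  by apply: polydomD => //; exact: polydomN.
by rewrite subr_ge0.
Qed.

Let Lsum (I : Type) (r : seq I) (F : I -> R -> R) :
  (forall i, polydom (F i)) ->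
  polydom (fun x => \sum_(i <- r) F i x) /\
  L (fun x => \sum_(i <- r) F i x) = \sum_(i <- r) L (F i).
Proof.
move=> pF; elim: r => [|i r [IH1 IH2]].
  rewrite big_nil; under eq_fun do rewrite big_nil.
  split; first exact: polydom_cst.
  rewrite -[RHS](mul0r (L (fun=> 1))) -LZ; last exact: polydom_cst.
  by congr L; apply/funext => x; rewrite mul0r.
rewrite big_cons -IH2 -LD//; under eq_fun do rewrite big_cons; split=> //.
exact: polydomD.
Qed.

(** As [L] is only finitely additive, this candidate for a distribution function need not be right
    continuous; [G] below is its right-continuous modification. *)
Let F a := L (step a).

Let F_le a b : a <= b -> F a <= F b.
Proof.
by move=> ab; apply: Lle; [exact: polydom_step..|move=> x; exact: step_le].
Qed.

Let F_le1 a : F a <= 1.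
Proof.
rewrite -Lunit; apply: Lle; [exact: polydom_step|exact: polydom_cst|].
by move=> x; exact: step_le1.
Qed.

Let F_ge0 a : 0 <= F a.
Proof. by apply: Lpos; [exact: polydom_step|move=> x; exact: step_ge0]. Qed.

Let M := L (horner ('X ^+ 2 + 1)).

(** Chebyshev's inequality, through x^2 + 1 >= 2 |x|. Because polynomials lie in the domain of [L],
    the limits of [G] at infinity are those of a probability. *)
Let F_tail (a : R) : 0 < a -> F (- a) <= M / a /\ 1 - M / a <= F a.
Proof.
move=> a0.
have pM : polydom (fun x => a^-1 * horner ('X ^+ 2 + 1) x).
  by apply: polydomZ; exact: polydom_poly.
have ME : L (fun x => a^-1 * horner ('X ^+ 2 + 1) x) = M / a.
  by rewrite mulrC; exact: (LZ a^-1 (polydom_poly ('X ^+ 2 + 1))).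
have key (x : R) : a <= `|x| -> 1 <= a^-1 * horner ('X ^+ 2 + 1) x.
  move=> ax; rewrite !hornerE ler_pdivlMl// mulr1.
  have -> : x ^+ 2 = `|x| ^+ 2 by rewrite real_normK ?num_real.
  have := sqr_ge0 (`|x| - 1); lra.
have pos (x : R) : 0 <= a^-1 * horner ('X ^+ 2 + 1) x.
  by rewrite !hornerE mulr_ge0 ?invr_ge0 ?(ltW a0)// addr_ge0// sqr_ge0.
split.
  rewrite -ME; apply: Lle; [exact: polydom_step|exact: pM|].
  move=> x; case: (leP x (- a)) => xa; last by rewrite step0//; exact: pos.
  by rewrite step1//; apply: key; rewrite ler_normr; apply/orP; right; lra.
have ME1 : L (fun x => 1 - a^-1 * horner ('X ^+ 2 + 1) x) = 1 - M / a.
  by rewrite -ME -[in RHS]Lunit; apply: LB => //; exact: polydom_cst.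
rewrite -ME1; apply: Lle; first by apply: polydomD; [exact: polydom_cst|exact: polydomN].
  exact: polydom_step.
move=> x; case: (leP x a) => xa.
  by have := pos x; rewrite step1//; lra.
have := key x; rewrite step0// ler_normr (ltW xa) => /(_ isT); lra.
Qed.

Let G x := inf [set F y | y in [set y | x < y]].

Let G_lb x : has_lbound [set F y | y in [set y | x < y]].
Proof. by exists 0 => _ [y _ <-]. Qed.

Let G_le x y : x < y -> G x <= F y.
Proof. by move=> xy; apply: ge_inf; [exact: G_lb|exists y]. Qed.

Let G_ge x c : (forall y, x < y -> c <= F y) -> c <= G x.
Proof.
move=> cF; apply: lb_le_inf; first by exists (F (x + 1)), (x + 1) => //=; lra.
by move=> _ [y xy <-]; exact: cF.
Qed.

Let G_nd : {homo G : x y / x <= y}.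
Proof.
by move=> x y xy; apply: G_ge => z yz; apply: G_le; exact: le_lt_trans yz.
Qed.

Let F_le_G x : F x <= G x.
Proof. by apply: G_ge => y /ltW; exact: F_le. Qed.

Let G_approx (x e : R) : 0 < e -> exists2 d : R, 0 < d &
  forall h : R, 0 < h -> h < d -> F (x + h) < G x + e.
Proof.
move=> e0.
have hi : has_inf [set F y | y in [set y | x < y]].
  by split; [exists (F (x + 1)), (x + 1) => //=; lra|exact: G_lb].
have [_ [y xy <-] Fy] := inf_adherent e0 hi.
exists (y - x); first by rewrite subr_gt0.
move=> h h0 hy; apply: le_lt_trans Fy; apply: F_le; lra.
Qed.

Let G_rc : forall x, G @ at_right x --> G x.
Proof.
move=> x; apply/cvgrPdist_le => e e0.
have [d d0 Gd] := G_approx x e0.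
near=> z.
have xz : x < z by near: z; exact: nbhs_right_gt.
have zd : z < x + d / 2 by near: z; apply: nbhs_right_lt; lra.
have xz' : G x <= G z by apply: G_nd; exact: ltW.
have : G z <= F (x + d / 2) by exact: G_le.
have : F (x + d / 2) < G x + e by apply: Gd; lra.
by move=> H1 H2; rewrite ler_norml; apply/andP; split; lra.
Unshelve. all: by end_near. Qed.

Let M0 : 0 <= M.
Proof.
apply: Lpos; first exact: polydom_poly.
by move=> x; rewrite !hornerE addr_ge0// sqr_ge0.
Qed.

Let MD (e x : R) : 0 < e -> M / e < x -> M / x <= e.
Proof.
move=> e0; have x0 : M / e < x -> 0 < x.
  by apply: le_lt_trans; rewrite divr_ge0// ltW.
by move=> Mx; rewrite ler_pdivrMr ?x0// mulrC -ler_pdivrMr// ltW.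
Qed.

Let G_y : G @ +oo --> (1 : R).
Proof.
apply/cvgrPdist_le => e e0; near=> x.
have x0 : 0 < x by near: x; apply: nbhs_pinfty_gt; exact: num_real.
have Mx : M / e < x by near: x; apply: nbhs_pinfty_gt; exact: num_real.
have [_ H1] := F_tail x0; have H2 := MD e0 Mx.
have H3 : G x <= 1 by apply: le_trans (F_le1 (x + 1)); apply: G_le; lra.
have H4 := F_le_G x.
by rewrite ler_norml; apply/andP; split; lra.
Unshelve. all: by end_near. Qed.

Let G_Ny : G @ -oo --> (0 : R).
Proof.
apply/cvgrPdist_le => e e0; near=> x.
have x0 : x < -1 by near: x; apply: nbhs_ninfty_lt; exact: num_real.
have Mx : x < - (M / e) - 1 by near: x; apply: nbhs_ninfty_lt; exact: num_real.
have H1 : F (- (- x - 1)) <= M / (- x - 1) by apply: (F_tail _).1; lra.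
have H2 : M / (- x - 1) <= e by apply: MD => //; lra.
have H3 : G x <= F (- (- x - 1)) by apply: G_le; lra.
have H4 : 0 <= G x by apply: le_trans (F_le_G x).
by rewrite ler_norml; apply/andP; split; lra.
Unshelve. all: by end_near. Qed.

(** One shift [h] serves finitely many nodes at once. Together with G (q i) <= F (q i + h), it
    bounds the increments of [G] by those of [F] over shifted nodes, up to [e]. *)
Let F_shift (q : nat -> R) e k : 0 < e -> exists2 d : R, 0 < d &
  forall h, 0 < h -> h < d -> forall i, (i < k)%N -> F (q i + h) < G (q i) + e.
Proof.
move=> e0; elim: k => [|k [d d0 IH]]; first by exists 1.
have [d' d'0 Gd] := G_approx (q k) e0.
exists (Num.min d d'); first by rewrite lt_min d0.
move=> h h0; rewrite lt_min => /andP[hd hd'] i; rewrite ltnS leq_eqVlt.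
by move=> /predU1P[->|ik]; [exact: Gd|exact: IH].
Qed.

Lemma representing_probability :
  exists nu : probability R R, forall a, nu `]-oo, a]%classic = (G a)%:E.
Proof. exact: probability_of_cdf. Qed.

Section representing_probability.
Context (nu : probability R R).
Hypothesis nuG : forall a, nu `]-oo, a]%classic = (G a)%:E.

Let L1_step a : L1 nu (step a).
Proof.
rewrite step_indic; apply: integrable_indic; exact: measurable_itv.
Qed.

Let Ex_step a : Ex nu (step a) = G a.
Proof.
rewrite step_indic /Ex /Rintegral integral_indic//= ?setIT ?nuG//.
Qed.

(** Riemann-Stieltjes comparison on ]-N, N]: an upper step function of [g] is integrated by [nu], a
    lower one over shifted nodes by [L]. The three [e] pay for the oscillation of [g] on either side
    and for passing from [G] to [F]. *)
Let Ex_window (g : R -> R) (e N : R) : continuous g -> polydom g -> (forall x, 0 <= g x) ->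
  0 < e -> 0 < N ->
  L1 nu (fun x => g x * (step N x - step (- N) x)) /\
  Ex nu (fun x => g x * (step N x - step (- N) x)) <= L g + 3 * e.
Proof.
move=> cg pg g0 e0 N0.
have [d d0 gd] := heine_cantor (- N) N cg e0.
have [m m0 mN] : exists2 m, (0 < m)%N & 2 * N < m%:R * (d / 2).
  have Nd : 0 < 2 * N / (d / 2) by rewrite !(divr_gt0, mulr_gt0).
  exists (Num.bound (2 * N / (d / 2))).
    by have := archi_boundP (ltW Nd); case: (Num.bound _) => //; rewrite ltNge (ltW Nd).
  rewrite -ltr_pdivrMr ?divr_gt0//; exact: archi_boundP (ltW Nd).
have m0' : 0 < m%:R :> R by rewrite ltr0n.
pose eta := 2 * N / m%:R; pose q (i : nat) : R := - N + i%:R * eta.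
have eta0 : 0 < eta by rewrite divr_gt0// mulr_gt0.
have etad : eta < d / 2 by rewrite /eta ltr_pdivrMr// (mulrC (d / 2)).
have q0 : q 0%N = - N by rewrite /q mul0r addr0.
have qm : q m = N by rewrite /q /eta mulrCA divff ?gt_eqF//; lra.
have qS i : q i.+1 = q i + eta by rewrite /q -natr1; ring.
have q_ge i : - N <= q i by rewrite /q lerDl mulr_ge0// ltW.
have q_le i : (i <= m)%N -> q i <= N.
  by move=> im; rewrite -qm /q lerD2l ler_pM2r// ler_nat.
have near_q i x : (i < m)%N -> q i < x -> x <= q i.+1 + (d / 2) ->
    `|g (q i.+1) - g x| < e.
  move=> im qx xq; apply: gd => //; first exact: q_le.
  by move: xq qx; rewrite qS ltr_norml => xq qx; apply/andP; split; lra.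
pose c i : R := g (q i.+1).
have c0 i : 0 <= c i by exact: g0.
have up x k : (k <= m)%N -> g x * (step (q k) x - step (q 0%N) x) <=
    \sum_(i < k) (c i + e) * (step (q i.+1) x - step (q i) x).
  elim: k => [|k IH] km; first by rewrite big_ord0 subrr mulr0.
  rewrite big_ord_recr/=; have := IH (ltnW km).
  suff : g x * (step (q k.+1) x - step (q k) x) <=
      (c k + e) * (step (q k.+1) x - step (q k) x) by lra.
  have [xq|qx] := leP x (q k).
    by rewrite !step1 ?subrr ?mulr0// qS; lra.
  rewrite (step0 qx) subr0; have [xq|qx'] := leP x (q k.+1); last first.
    by rewrite (step0 qx') !mulr0.
  rewrite (step1 xq) !mulr1; have := near_q k x km qx.
  by rewrite ltr_norml => /(_ _)/andP[|H _]; rewrite /c; lra.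
(* On the last shifted cell [x] may exceed [N], by less than d / 2; the node q i.+1 stays in
   [-N, N], which is all that [heine_cantor] asks. *)
have down h x k : 0 < h -> h < d / 2 -> (k <= m)%N ->
    \sum_(i < k) c i * (step (q i.+1 + h) x - step (q i + h) x) <=
      (g x + e) * (step (q k + h) x - step (q 0%N + h) x).
  move=> h0 hd; elim: k => [|k IH] km; first by rewrite big_ord0 subrr mulr0.
  rewrite big_ord_recr/=; have := IH (ltnW km).
  suff : c k * (step (q k.+1 + h) x - step (q k + h) x) <=
      (g x + e) * (step (q k.+1 + h) x - step (q k + h) x) by lra.
  have [xq|qx] := leP x (q k + h).
    by rewrite !step1 ?subrr ?mulr0// qS; lra.
  rewrite (step0 qx) subr0; have [xq|qx'] := leP x (q k.+1 + h); last first.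
    by rewrite (step0 qx') !mulr0.
  rewrite (step1 xq) !mulr1; have := near_q k x km.
  by rewrite ltr_norml => /(_ _ _)/andP[||_ H]; rewrite /c; lra.
have [W1 H1] : L1 nu (fun x => g x * (step N x - step (- N) x)) /\
    Ex nu (fun x => g x * (step N x - step (- N) x)) <=
    \sum_(i < m) (c i + e) * (G (q i.+1) - G (q i)).
  have L1d i : L1 nu (fun x => step (q i.+1) x - step (q i) x) by exact: L1B.
  have -> : \sum_(i < m) (c i + e) * (G (q i.+1) - G (q i)) =
     Ex nu (fun x => \sum_(i < m) (c i + e) * (step (q i.+1) x - step (q i) x)).
    rewrite Ex_sum; last by move=> i; exact: L1Z.
    by apply: eq_bigr => i _; rewrite ExZ// ExB// !Ex_step.
  have up' x := up x m (leqnn m).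
  have W1 : L1 nu (fun x => g x * (step N x - step (- N) x)).
    apply: (@L1_le _ _ _ _ _ (fun x =>
      \sum_(i < m) (c i + e) * (step (q i.+1) x - step (q i) x))).
    + apply: measurable_funM; first exact: continuous_measurable_fun.
      by apply: measurable_funB; exact: L1_measurable (L1_step _).
    + move=> x; rewrite ger0_norm; first by rewrite -{1}qm -q0.
      by rewrite mulr_ge0// subr_ge0 step_le//; lra.
    + by apply: L1_sum => i; exact: L1Z.
  split=> //; apply: Ex_le => //.
  - by apply: L1_sum => i; exact: L1Z.
  - by move=> x; rewrite -{1}qm -q0.
pose S := \sum_(i < m) c i.
have S0 : 0 <= S by apply: sumr_ge0.
(* The error allowed at each node: weighted by the heights [c i] it adds up to at most [e]. *)
have e'0 : 0 < e / (S + 1) by rewrite divr_gt0// ltr_wpDl.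
have [d' d'0 Fd] := F_shift q m e'0.
pose h := Num.min d' (d / 2) / 2.
have h0 : 0 < h by rewrite divr_gt0// lt_min d'0 divr_gt0.
have hlt : h < Num.min d' (d / 2).
  by rewrite /h ltr_pdivrMr// ltr_pMr ?ltr1n// lt_min d'0 divr_gt0.
have [hd' hd] : h < d' /\ h < d / 2 by apply/andP; rewrite -lt_min.
have H2 : \sum_(i < m) c i * (F (q i.+1 + h) - F (q i + h)) <= L g + e.
  have pd i : polydom (fun x => step (q i.+1 + h) x - step (q i + h) x).
    by apply: polydomD; [exact: polydom_step|apply: polydomN; exact: polydom_step].
  have -> : \sum_(i < m) c i * (F (q i.+1 + h) - F (q i + h)) =
    L (fun x => \sum_(i < m) c i * (step (q i.+1 + h) x - step (q i + h) x)).
    rewrite (Lsum _ _).2; last by move=> i; exact: polydomZ.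
    apply: eq_bigr => i _; rewrite LZ//; congr (_ * _).
    by rewrite LB//; exact: polydom_step.
  have Le : L (fun x => g x + e) = L g + e.
    rewrite LD//; last exact: polydom_cst.
    by rewrite Lcst.
  rewrite -Le; apply: Lle.
  - by apply: (Lsum _ _).1 => i; exact: polydomZ.
  - by apply: polydomD => //; exact: polydom_cst.
  - move=> x; apply: le_trans (down h x m h0 hd (leqnn m)) _.
    rewrite -[leRHS]mulr1 ler_wpM2l//; first by have := g0 x; lra.
    have := step_ge0 (q 0%N + h) x; have := step_le1 (q m + h) x; lra.
have H3 : \sum_(i < m) (c i + e) * (G (q i.+1) - G (q i)) <=
    \sum_(i < m) c i * (F (q i.+1 + h) - F (q i + h)) + 2 * e.
  have -> : \sum_(i < m) (c i + e) * (G (q i.+1) - G (q i)) =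
      \sum_(i < m) c i * (G (q i.+1) - G (q i)) + e * (G (q m) - G (q 0%N)).
    under eq_bigr do rewrite mulrDl.
    rewrite big_split/= -mulr_sumr; congr (_ + _ * _).
    by rewrite -(big_mkord predT (fun i => G (q i.+1) - G (q i))) telescope_sumr.
  have HG : e * (G (q m) - G (q 0%N)) <= e.
    have : G (q m) <= 1 by apply: le_trans (F_le1 (q m + 1)); apply: G_le; lra.
    have : 0 <= G (q 0%N) by apply: le_trans (F_le_G _).
    by nra.
  have : \sum_(i < m) c i * (G (q i.+1) - G (q i)) <=
      \sum_(i < m) (c i * (F (q i.+1 + h) - F (q i + h)) + c i * (e / (S + 1))).
    apply: ler_sum => i _; rewrite -mulrDr ler_wpM2l//.
    have := Fd h h0 hd' i (ltn_ord i).
    have : G (q i.+1) <= F (q i.+1 + h) by apply: G_le; lra.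
    lra.
  rewrite big_split/= -mulr_suml -/S.
  have : S * (e / (S + 1)) <= e.
    by rewrite mulrA ler_pdivrMr ?ltr_wpDl// mulrC ler_pM2l//; lra.
  lra.
by split=> //; lra.
Qed.

(** Monotone convergence along windows exhausting the line. This argument alone gives only an
    inequality, as mass of [L] near infinity is not seen by any window. *)
Let integral_le g : continuous g -> polydom g -> (forall x, 0 <= g x) ->
  (\int[nu]_x (g x)%:E <= (L g)%:E)%E.
Proof.
move=> cg pg g0.
pose u (n : nat) (x : R) : R := g x * (step n.+1%:R x - step (- n.+1%:R) x).
have mg : measurable_fun setT g by exact: continuous_measurable_fun.
have mu n : measurable_fun setT (u n).
  by apply: measurable_funM => //; apply: measurable_funB; exact: L1_measurable (L1_step _).
have u0 n x : 0 <= u n x.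
  rewrite mulr_ge0// subr_ge0 step_le//.
  have : 0 <= n.+1%:R :> R by exact: ler0n.
  lra.
have und x : {homo u ^~ x : n m / (n <= m)%N >-> n <= m}.
  move=> n m nm; rewrite ler_wpM2l//.
  have nm' : n.+1%:R <= m.+1%:R :> R by rewrite ler_nat.
  have := step_le x nm'; have : - m.+1%:R <= - n.+1%:R :> R by rewrite lerN2.
  by move=> /(step_le x); lra.
have ucvg x : (u n x)%:E @[n --> \oo] --> (g x)%:E.
  apply/cvg_EFin; first exact: nearW.
  apply: cvg_near_cst; near=> n.
  have xn : `|x| <= n%:R by near: n; exact: nbhs_infty_ger.
  have xn1 : `|x| < n.+1%:R by apply: le_lt_trans xn _; rewrite ltr_nat.
  move: xn1; rewrite ltr_norml => /andP[H1 H2].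
  by rewrite /u /= (step1 (ltW H2)) (step0 H1) subr0 mulr1.
have muE n : measurable_fun setT (fun x => (u n x)%:E).
  exact/measurable_EFinP.
have H := @cvg_monotone_convergence _ _ R nu setT measurableT
  (fun n x => (u n x)%:E) muE (fun n x _ => u0 n x) (fun x _ => und x).
have gE : (\int[nu]_x (g x)%:E = limn (fun n => \int[nu]_x (u n x)%:E))%E.
  rewrite (cvg_lim (@ereal_hausdorff R) H).
  by apply: eq_integral => x _; exact/esym/(cvg_lim (@ereal_hausdorff R))/ucvg.
rewrite gE; apply: lime_le; first by apply/cvg_ex; eexists; exact: H.
apply: nearW => n.
have n0 : 0 < n.+1%:R :> R by rewrite ltr0n.
have [un1 _] := Ex_window cg pg g0 ltr01 n0.
rewrite (integral_Ex un1) lee_fin; apply/ler_addgt0Pr => e e0.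
have e30 : 0 < e / 3 by rewrite divr_gt0.
have [_] := Ex_window cg pg g0 e30 n0.
by rewrite mulrCA mulfV ?mulr1 ?pnatr_eq0.
Unshelve. all: by end_near. Qed.

Let L1_polydom h : continuous h -> polydom h -> L1 nu h.
Proof.
move=> ch ph; apply/integrableP; split.
  by apply/measurable_EFinP; exact: continuous_measurable_fun.
apply: le_lt_trans (ltry (L (fun x => `|h x|))).
apply: (integral_le _ (polydom_norm ph)) => [x|x]; last exact: normr_ge0.
by apply: cvg_norm; exact: ch.
Qed.

Let Ex_le_polydom h : continuous h -> polydom h -> (forall x, 0 <= h x) ->
  Ex nu h <= L h.
Proof.
move=> ch ph h0; rewrite -lee_fin -integral_Ex; last exact: L1_polydom.
exact: integral_le.
Qed.

(* AM-GM: [h <= k + h^2 / 4k], and both sides are functions that [L]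
   integrates; let [k] tend to infinity. *)
Let le_Ex_polydom h : continuous h -> polydom h -> L h <= Ex nu h.
Proof.
move=> ch ph; apply/ler_addgt0Pr => e e0.
have ch2 : continuous (fun x => h x * h x).
  by move=> x; apply: cvgM; exact: ch.
have ph2 := polydomM ph ph.
pose B := L (fun x => h x * h x).
have B0 : 0 <= B by apply: Lpos => // x; rewrite -expr2 sqr_ge0.
pose k := (B + 1) / e.
have k0 : 0 < k by rewrite divr_gt0// ltr_wpDl.
have k40 : 0 < (4 * k)^-1 by rewrite invr_gt0 mulr_gt0.
pose r x := k + ((4 * k)^-1 * (h x * h x) - h x).
have cr : continuous r.
  move=> x; apply: cvgD; first exact: cvg_cst.
  apply: cvgB; last exact: ch.
  by apply: cvgM; [exact: cvg_cst|exact: ch2].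
have pk := polydom_cst k.
have pr2 := polydomZ (4 * k)^-1 ph2.
have pd : polydom (fun x => (4 * k)^-1 * (h x * h x) - h x).
  by apply: polydomD => //; exact: polydomN.
have pr : polydom r by exact: polydomD.
have r0 x : 0 <= r x.
  have -> : r x = (4 * k)^-1 * (h x - 2 * k) ^+ 2.
    by rewrite /r; field; rewrite gt_eqF.
  by rewrite mulr_ge0 ?(ltW k40)// sqr_ge0.
have := Ex_le_polydom cr pr r0.
have -> : L r = k + ((4 * k)^-1 * B - L h).
  by rewrite /r (LD pk pd) (LB pr2 ph) (LZ _ ph2) Lcst.
have L1h := L1_polydom ch ph; have L1h2 := L1_polydom ch2 ph2.
have -> : Ex nu r = k + ((4 * k)^-1 * Ex nu (fun x => h x * h x) - Ex nu h).
  have p1 := L1Z (4 * k)^-1 L1h2; have p2 := L1B p1 L1h.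
  by rewrite /r (ExD (L1_cst _ k) p2) (ExB p1 L1h) (ExZ _ L1h2) Ex_cst.
have : 0 <= (4 * k)^-1 * Ex nu (fun x => h x * h x).
  by apply: mulr_ge0 (ltW k40) _; apply: Ex_ge0 => x; rewrite -expr2 sqr_ge0.
have : (4 * k)^-1 * B <= e.
  have ke : k * e = B + 1 by rewrite /k divfK// gt_eqF.
  have k4 : 0 < 4 * k by rewrite pmulr_rgt0.
  rewrite ler_pdivrMl//.
  have -> : 4 * k * e = 4 * (B + 1) by rewrite -ke; ring.
  lra.
lra.
Qed.

Lemma Ex_representing h : continuous h -> polydom h ->
  L1 nu h /\ Ex nu h = L h.
Proof.
move=> ch ph; have h1 := L1_polydom ch ph; split=> //.
apply/eqP; rewrite eq_le le_Ex_polydom// andbT.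
have chN : continuous (fun x => - h x) by move=> x; apply: cvgN; exact: ch.
have := le_Ex_polydom chN (polydomN ph).
have -> : L (fun x => - h x) = - L h.
  by rewrite -mulN1r -LZ//; congr L; apply/funext => x; rewrite mulN1r.
have -> : Ex nu (fun x => - h x) = - Ex nu h.
  rewrite -mulN1r -ExZ//; congr Ex; apply/funext => x; by rewrite mulN1r.
by rewrite lerN2.
Qed.

End representing_probability.

End representation.

(** A Riesz representation on a non-compact line. Equality holds for every continuous function of
    polynomial growth, because the square of such a function is again in the domain and controls its
    tail. *)
Theorem positive_functional_probability (R : realType) (L : (R -> R) -> R) :
  linear_functional L ->
  (forall h, polydom h -> (forall x, 0 <= h x) -> 0 <= L h) ->
  L (fun=> 1) = 1 ->
  exists nu : probability R R, forall h, continuous h -> polydom h ->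
    L1 nu h /\ Ex nu h = L h.
Proof.
move=> Llin Lpos Lunit.
have [nu nuG] := representing_probability Llin Lpos Lunit.
by exists nu => h; exact: Ex_representing.
Qed.

(** * Poisson kernels *)

Section uniqueness.
Context (R : realType) (d : measure_display) (T : measurableType d)
  (P : probability T R).
Implicit Types (V Z Y : T -> R).

(** [V] is signed, so the argument is made on events: those over which [V] integrates to zero form a
    lambda-system, by dominated convergence for increasing unions. *)
Lemma Ex_pi_lambda V (C : set (set T)) : L1 P V -> Ex P V = 0 ->
  setI_closed C -> (forall A, C A -> measurable A) ->
  (forall A, C A -> Ex P (fun w => V w * \1_A w) = 0) ->
  forall A, <<s C >> A -> measurable A /\ Ex P (fun w => V w * \1_A w) = 0.
Proof.
move=> V1 V0 CI Cm CV.
pose H := [set A | measurable A /\ Ex P (fun w => V w * \1_A w) = 0].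
suff : <<s C >> `<=` H by move=> sub A /sub.
apply: lambda_system_subset => //; last by move=> A CA; split; [exact: Cm|exact: CV].
split=> //.
- split; first exact: measurableT.
  by rewrite -[RHS]V0; congr Ex; apply/funext => w; rewrite indicT mulr1.
- move=> A B BA [mA VA] [mB VB]; split; first exact: measurableD.
  have -> : (fun w => V w * \1_(A `\` B) w) =
      (fun w => V w * \1_A w - V w * \1_B w).
    apply/funext => w; rewrite -mulrBr; congr (_ * _).
    rewrite !indicE in_setD; case: (boolP (w \in B)) => wB /=.
      have -> : w \in A by rewrite inE; apply: BA; exact/set_mem.
      by rewrite subrr.
    by rewrite andbT subr0.
  by rewrite ExB ?VA ?VB ?subrr//; exact: L1_indic.
- move=> F Fnd HF; have mF n : measurable (F n) by have [] := HF n.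
  split; first exact: bigcup_measurable.
  have [||||_] := @Ex_dominated _ _ _ P (fun n w => V w * \1_(F n) w)
    (fun w => V w * \1_(\bigcup_n F n) w) (fun w => `|V w|).
  + by move=> n; exact: L1_measurable (L1_indic (mF n) V1).
  + move=> w; apply: cvgMr.
    have [[N _ FN]|nF] := pselect ((\bigcup_n F n) w).
      apply: cvg_near_cst; near=> n; rewrite !indicE !mem_set//; first by exists N.
      have /subsetPset : (F N <= F n)%O by apply: Fnd; near: n; exact: nbhs_infty_ge.
      exact.
    apply: cvg_near_cst; apply: nearW => n; rewrite !indicE !memNset//.
    by move=> Fn; apply: nF; exists n.
  + by move=> n w; rewrite normrM ler_piMr// indic_le1.
  + exact: integrable_norm.
  under eq_fun do rewrite (HF _).2.
  by move=> /cvg_lim <-//; rewrite lim_cst.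
Unshelve. all: by end_near. Qed.

Lemma Ex_rays Z Y : L1 P Z -> measurable_fun setT Y -> Ex P Z = 0 ->
  (forall c, Ex P (fun w => Z w * \1_(Y @^-1` `]-oo, c]) w) = 0) ->
  forall B, measurable B -> Ex P (fun w => Z w * \1_(Y @^-1` B) w) = 0.
Proof.
move=> Z1 mY Z0 ZY B mB.
pose C := [set A | exists c : R, A = Y @^-1` `]-oo, c]%classic].
have CI : setI_closed C.
  move=> _ _ [a ->] [b ->]; exists (Num.min a b).
  apply/seteqP; split => w /=; rewrite !in_itv/= le_min.
    by move=> [-> ->].
  by move=> /andP[].
have Cm A : C A -> measurable A.
  by move=> [c ->]; rewrite -[X in measurable X]setTI; exact: mY.
have CV A : C A -> Ex P (fun w => Z w * \1_A w) = 0.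
  by move=> [c ->]; exact: ZY.
suff sB : <<s C >> (Y @^-1` B).
  by have [] := Ex_pi_lambda Z1 Z0 CI Cm CV sB.
have sC : sigma_algebra setT <<s C >> by exact: smallest_sigma_algebra.
have [sC0 sCC sCU] := sC.
pose S := [set B : set R | <<s C >> (Y @^-1` B)].
have Ssig : sigma_algebra setT S.
  split; first by rewrite /S/= preimage_set0.
    move=> A SA; rewrite /S/= setTD preimage_setC -setTD; exact: sCC.
  by move=> F SF; rewrite /S/= preimage_bigcup; exact: sCU.
suff : measurable `<=` S by move=> /(_ _ mB).
rewrite (_ : measurable = <<s @ocitv R >>); last by [].
apply: smallest_sub => // _ [[a b] _ <-] /=.
rewrite /S/= (_ : `]a, b]%classic = `]-oo, b]%classic `\` `]-oo, a]%classic).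
  have Sray c : <<s C >> (Y @^-1` `]-oo, c]%classic).
    by apply: sub_sigma_algebra; exists c.
  exact: (@measurableD _ (g_sigma_algebraType C) _ _ (Sray b) (Sray a)).
apply/seteqP; split=> x /=; rewrite !in_itv/=.
  by move=> /andP[ax ->]; split=> //; apply/negP; rewrite -ltNge.
by move=> [-> /negP]; rewrite -ltNge => ->.
Qed.

Lemma cvg_atan_pinfty (u : nat -> R) :
  (forall A, \forall n \near \oo, A <= u n) ->
  atan (u n) @[n --> \oo] --> pi / 2.
Proof.
by move=> uA; apply: (cvg_comp _ _ _ (@cvgy_atan R)); exact/cvgryPge.
Qed.

(* Integrating the Poisson kernel in [a] gives an arctangent, and scaled
   arctangents converge to the signs of [c - Y]. *)
Lemma Ex_poisson_inversion Z Y : L1 P Z -> measurable_fun setT Y ->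
  Ex P Z = 0 ->
  (forall a b, 0 < b ->
     Ex P (fun w => Z w * (b / ((Y w - a) ^+ 2 + b ^+ 2))) = 0) ->
  forall B, measurable B -> Ex P (fun w => Z w * \1_(Y @^-1` B) w) = 0.
Proof.
move=> Z1 mY Z0 poisson; apply: Ex_rays => // c.
have mZ := L1_measurable Z1.
have matan : measurable_fun setT (@atan R).
  by apply: continuous_measurable_fun => x; exact: continuous_atan.
have atan_bd x : `|@atan R x| <= pi / 2.
  by rewrite ler_norml (ltW (atan_gtNpi2 x)) (ltW (atan_ltpi2 x)).
(* An antiderivative in [x] of the Poisson integral with a = x and b = 1/k; its derivative therefore
   vanishes. *)
pose phi (k x : R) := Ex P (fun w => Z w * atan (k * (x - Y w))).
have L1phi k x : L1 P (fun w => Z w * atan (k * (x - Y w))).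
  apply: (@L1M _ _ _ _ Z (pi / 2) (fun w => atan (k * (x - Y w)))) => //.
  apply: measurableT_comp => //; apply: measurable_funM => //.
  exact: measurable_funB.
have gt0 (k x y : R) : 0 < 1 + (k * (x - y)) ^+ 2 by rewrite ltr_wpDr ?sqr_ge0.
have dphi (k : R) : 0 < k -> forall x : R, is_derive x (1 : R) (phi k) (0 : R).
  move=> k0 x.
  pose f (x : R) (w : T) : R := Z w * atan (k * (x - Y w)).
  have df (y : R) w : is_derive y (1 : R) (f ^~ w) (Z w * (k / (1 + (k * (y - Y w)) ^+ 2))).
    have H0 : is_derive y (1 : R) (fun x : R => x - Y w) (1 - 0).
      exact: (is_deriveB (is_derive_id y (1 : R)) (is_derive_cst (Y w) y (1 : R))).
    have H1 : is_derive y (1 : R) (fun x : R => k * (x - Y w)) (k * (1 - 0)).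
      exact: (is_deriveZ k H0).
    have H2 := is_derive1_atan (k * (y - Y w)).
    have H3 : is_derive y (1 : R) (@atan R \o (fun x : R => k * (x - Y w)))
        ((1 + (k * (y - Y w)) ^+ 2)^-1 * (k * (1 - 0))).
      exact: is_derive1_comp.
    have H4 := is_deriveZ (Z w) H3.
    apply: (is_derive_eq H4).
    by rewrite subr0 mulr1 /GRing.scale/= (mulrC _ k).
  have pE y w : partial1of2 f y w = Z w * (k / (1 + (k * (y - Y w)) ^+ 2)).
    by rewrite partial1of2E; have dfyw := df y w; exact: derive_val.
  have Ix : `]x - 1, x + 1[%classic x by rewrite /= in_itv/=; apply/andP; split; lra.
  have mT : measurable [set: T] by exact: measurableT.
  have intf y : `]x - 1, x + 1[%classic y -> P.-integrable setT (EFin \o f y).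
    by move=> _; exact: L1phi.
  have derf y w : `]x - 1, x + 1[%classic y -> setT w -> derivable (f ^~ w) y 1.
    by move=> _ _; have dfyw := df y w; exact: ex_derive.
  have G1 : L1 P (fun w => k * `|Z w|) by apply: L1Z; exact: integrable_norm.
  have G0 w : 0 <= k * `|Z w| by rewrite mulr_ge0// ltW.
  have Gub y w : `]x - 1, x + 1[%classic y -> setT w -> `|partial1of2 f y w| <= k * `|Z w|.
    move=> _ _; rewrite pE normrM mulrC ler_wpM2r// ger0_norm; last first.
      by rewrite divr_ge0 ?ltW.
    rewrite ler_pdivrMr// ler_pMr// lerDl sqr_ge0.
    by [].
  have D := derivable_under_integral mT Ix intf derf G0 G1 Gub.
  have E := differentiation_under_integral mT Ix intf derf G0 G1 Gub.
  apply: DeriveDef; first exact: D.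
  rewrite -derive1E E.
  have := poisson x k^-1; rewrite invr_gt0 => /(_ k0) <-.
  apply: eq_Rintegral => w _; rewrite pE; congr (_ * _).
  have H := gt0 k x (Y w).
  have kn : k != 0 by rewrite gt_eqF.
  have H' : 0 < (Y w - x) ^+ 2 + k^-1 ^+ 2.
    by rewrite ltr_wpDl ?sqr_ge0// exprn_gt0// invr_gt0.
  apply/eqP; rewrite eqr_div; [|by rewrite gt_eqF|by rewrite gt_eqF].
  by apply/eqP; field.
have phi_cst k : 0 < k -> forall x y, phi k x = phi k y.
  by move=> k0 x y; apply: is_derive_0_is_cst; exact: dphi.
have phi0 k : 0 < k -> forall x, phi k x = 0.
  move=> k0 x.
  (* The constant [phi k] is identified by letting its argument tend to minus infinity: it equals -
     (pi / 2) E Z = 0. *)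
  have [||||_] := @Ex_dominated _ _ _ P (fun n w => Z w * atan (k * (- n%:R - Y w)))
    (fun w => Z w * (- (pi / 2))) (fun w => pi / 2 * `|Z w|).
  - by move=> n; exact: L1_measurable (L1phi k (- n%:R)).
  - move=> w; apply: cvgMr.
    rewrite (_ : (fun n : nat => atan (k * (- n%:R - Y w))) =
        (fun n : nat => - atan (k * (n%:R + Y w)))); last first.
      by apply/funext => n; rewrite -atanN; congr atan; ring.
    apply: cvgN; apply: cvg_atan_pinfty => A; near=> n.
    have : A / k - Y w <= n%:R by near: n; exact: nbhs_infty_ger.
    by rewrite lerBlDr ler_pdivrMr// mulrC.
  - by move=> n w; rewrite normrM mulrC ler_wpM2r.
  - by apply: L1Z; exact: integrable_norm.
  have -> : (fun n : nat => Ex P (fun w => Z w * atan (k * (- n%:R - Y w)))) = (fun=> phi k x).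
    by apply/funext => n; apply: phi_cst.
  move=> H; rewrite (cvg_unique (@Rhausdorff R) (cvg_cst (phi k x)) H).
  under eq_fun do rewrite mulrC; rewrite ExZ//.
  by rewrite Z0 mulr0.
(* With N = n + 1 the arctangent has argument N (N (c - Y) + 1). The shift of [c] by 1/N makes it
   tend to plus infinity also where Y = c, so the limit sees the closed ray. *)
have [||||_] := @Ex_dominated _ _ _ P
    (fun n w => Z w * atan (n.+1%:R ^+ 2 * (c + n.+1%:R^-1 - Y w)))
    (fun w => Z w * (pi * \1_(Y @^-1` `]-oo, c]) w - pi / 2))
    (fun w => pi / 2 * `|Z w|).
- by move=> n; exact: L1_measurable (L1phi (n.+1%:R ^+ 2) (c + n.+1%:R^-1)).
- move=> w; apply: cvgMr.
  have nS (n : nat) : n%:R <= n.+1%:R :> R by rewrite ler_nat.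
  have n0 (n : nat) : 0 < n.+1%:R :> R by rewrite ltr0n.
  have E (n : nat) : n.+1%:R ^+ 2 * (c + n.+1%:R^-1 - Y w) =
      n.+1%:R * (n.+1%:R * (c - Y w) + 1).
    by field; rewrite gt_eqF.
  rewrite indicE; case: (leP (Y w) c) => Yc.
    rewrite mem_set ?mulr1; last by rewrite /= in_itv.
    rewrite (_ : pi - pi / 2 = pi / 2); last by lra.
    apply: cvg_atan_pinfty => A; near=> n.
    have An : A <= n%:R by near: n; exact: nbhs_infty_ger.
    rewrite E; have := nS n; have := n0 n; have : 0 <= c - Y w by rewrite subr_ge0.
    move: An; set N := n.+1%:R; set m := n%:R => An H1 H2 H3.
    by have := mulr_ge0 (sqr_ge0 N) H1; lra.
  rewrite memNset; last by rewrite /= in_itv/= leNgt Yc.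
  rewrite mulr0 add0r.
  rewrite (_ : (fun n : nat => atan (n.+1%:R ^+ 2 * (c + n.+1%:R^-1 - Y w))) =
      (fun n : nat => - atan (n.+1%:R * (n.+1%:R * (Y w - c) - 1)))); last first.
    by apply/funext => n; rewrite E -atanN; congr atan; ring.
  apply: cvgN; apply: cvg_atan_pinfty => A; near=> n.
  have An : A <= n%:R by near: n; exact: nbhs_infty_ger.
  have : 2 / (Y w - c) <= n%:R by near: n; exact: nbhs_infty_ger.
  rewrite ler_pdivrMr ?subr_gt0// => H.
  have := nS n; have := n0 n; have : 0 < Y w - c by rewrite subr_gt0.
  move: An H; set N := n.+1%:R; set m := n%:R; set D := Y w - c => An H H1 H2 H3.
  have H4 : 0 <= (N - m) * D by rewrite mulr_ge0 ?subr_ge0// ltW.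
  have H5 : 0 <= N * (N * D - 2) by apply: mulr_ge0; [exact: ltW|lra].
  by lra.
- by move=> n w; rewrite normrM mulrC ler_wpM2r.
- by apply: L1Z; exact: integrable_norm.
have -> : (fun n : nat => Ex P (fun w => Z w * atan (n.+1%:R ^+ 2 * (c + n.+1%:R^-1 - Y w))))
    = (fun=> 0).
  by apply/funext => n; apply: phi0; rewrite exprn_gt0.
move=> /(cvg_unique (@Rhausdorff R) (cvg_cst (0 : R))) H.
have mA : measurable (Y @^-1` `]-oo, c]%classic).
  by rewrite -[X in measurable X]setTI; apply: mY => //; exact: measurable_itv.
have ZA := L1_indic mA Z1.
have : Ex P (fun w => pi * (Z w * \1_(Y @^-1` `]-oo, c]) w) - pi / 2 * Z w) = 0.
  by rewrite [RHS]H; congr Ex; apply/funext => w; ring.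
rewrite ExB ?ExZ//; [|exact: L1Z|exact: L1Z].
rewrite Z0 mulr0 subr0 => /eqP; rewrite mulf_eq0 gt_eqF ?pi_gt0//= => /eqP.
exact.
Unshelve. all: by end_near. Qed.

End uniqueness.

(** * Density of polynomials for a determinate law *)

Section riesz.
Context (R : realType) (d : measure_display) (T : measurableType d)
  (P : probability T R) (Y : T -> R).
Hypothesis mY : measurable_fun setT Y.
Hypothesis Y1 : forall n, L1 P (fun w => Y w ^+ n).

Let hornerE_sum (p : {poly R}) :
  (fun w => p.[Y w]) = (fun w => \sum_(i < size p) p`_i * Y w ^+ i).
Proof. by apply/funext => w; rewrite horner_coef. Qed.

Lemma L1_horner (p : {poly R}) : L1 P (fun w => p.[Y w]).
Proof. by rewrite hornerE_sum; apply: L1_sum => i; exact: L1Z. Qed.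

Lemma L2_horner (p : {poly R}) : L2 P (fun w => p.[Y w]).
Proof.
split; first exact: L1_measurable (L1_horner p).
by have := L1_horner (p ^+ 2); under eq_fun do rewrite horner_exp.
Qed.

Lemma Ex_horner_orthogonal (Z : T -> R) : L2 P Z ->
  (forall n, Ex P (fun w => Z w * Y w ^+ n) = 0) ->
  forall p : {poly R}, Ex P (fun w => Z w * p.[Y w]) = 0.
Proof.
move=> Z2 ZY p.
have ZY1 n : L1 P (fun w => Z w * Y w ^+ n).
  have := L2M Z2 (L2_horner 'X^n); congr L1; apply/funext => w.
  by rewrite hornerXn.
have -> : (fun w => Z w * p.[Y w]) =
    (fun w => \sum_(i < size p) p`_i * (Z w * Y w ^+ i)).
  apply/funext => w; rewrite horner_coef mulr_sumr.
  by apply: eq_bigr => i _; rewrite mulrCA.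
rewrite Ex_sum; last by move=> i; exact: L1Z.
by rewrite big1// => i _; rewrite ExZ// ZY mulr0.
Qed.

Lemma L2_bounded (f g : T -> R) k : L2 P f -> measurable_fun setT g ->
  (forall w, `|g w| <= k) -> L2 P (fun w => f w * g w).
Proof.
move=> [mf f2] mg gk; split; first exact: measurable_funM.
under eq_fun => w do rewrite exprMn.
apply: (@L1M _ _ _ _ _ (k ^+ 2)) => //; first exact: measurable_funX.
by move=> w; rewrite normrX ler_sqr ?nnegrE ?(le_trans _ (gk w)).
Qed.

Section kernel.
Context (Z : T -> R) (a b : R).
Hypothesis Z2 : L2 P Z.
Hypothesis ZY : forall n, Ex P (fun w => Z w * Y w ^+ n) = 0.
Hypothesis b0 : 0 < b.

Let D (x : R) := (x - a) ^+ 2 + b ^+ 2.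
Let Dp : {poly R} := ('X - a%:P) ^+ 2 + (b ^+ 2)%:P.

Let DpE x : Dp.[x] = D x.
Proof. by rewrite /Dp !hornerE. Qed.

Let D_ge x : b ^+ 2 <= D x.
Proof. by rewrite /D lerDr sqr_ge0. Qed.

Let D_gt0 x : 0 < D x.
Proof. by apply: lt_le_trans (D_ge x); rewrite exprn_gt0. Qed.

Let Dinv_le x : `|(D x)^-1| <= b ^- 2.
Proof.
rewrite ger0_norm ?invr_ge0 ?(ltW (D_gt0 x))//.
by rewrite lef_pV2 ?posrE ?exprn_gt0// D_ge.
Qed.

Let mDinv : measurable_fun setT (fun w => (D (Y w))^-1).
Proof.
have cD : continuous (fun x : R => (D x)^-1).
  move=> x; apply: cvgV; first by rewrite gt_eqF// D_gt0.
  have -> : D = horner Dp by apply/funext => y; rewrite DpE.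
  exact: continuous_horner.
exact: (measurableT_comp (continuous_measurable_fun cD) mY).
Qed.

Let L2_frac (p : {poly R}) : L2 P (fun w => p.[Y w] / D (Y w)).
Proof. exact: L2_bounded (L2_horner p) mDinv (fun w => Dinv_le (Y w)). Qed.

Let kappa := Ex P (fun w => Z w ^+ 2).
(** With z = a + ib one has D x = |x - z|^2, and S' + i S is E(Z / (Y - z)). *)
Let S := Ex P (fun w => Z w * (b / D (Y w))).
Let S' := Ex P (fun w => Z w * ((Y w - a) / D (Y w))).

Let frac_cst (c : R) : (fun w => c / D (Y w)) = (fun w => c%:P.[Y w] / D (Y w)).
Proof. by apply/funext => w; rewrite hornerC. Qed.

Let frac_lin : (fun w => (Y w - a) / D (Y w)) =
  (fun w => ('X - a%:P).[Y w] / D (Y w)).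
Proof. by apply/funext => w; rewrite !hornerE. Qed.

(* The real and imaginary parts of [q(z) / (Y - z)], [z = a + i b], where
   [q = q1 + i q2] reduces modulo [(X - z)] to [u + i v]. *)
Let Ex_frac (r : {poly R}) (u v : R) :
  Ex P (fun w => Z w * (r.[Y w] + (u * (Y w - a) - v * b) / D (Y w))) =
    u * S' - v * S.
Proof.
have L2b : L2 P (fun w => b / D (Y w)) by rewrite frac_cst; exact: L2_frac.
have L2t : L2 P (fun w => (Y w - a) / D (Y w)) by rewrite frac_lin; exact: L2_frac.
have Zr := L2M Z2 (L2_horner r); have Zb := L2M Z2 L2b; have Zt := L2M Z2 L2t.
have -> : (fun w => Z w * (r.[Y w] + (u * (Y w - a) - v * b) / D (Y w))) =
    (fun w => Z w * r.[Y w] + (u * (Z w * ((Y w - a) / D (Y w))) -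
              v * (Z w * (b / D (Y w))))).
  by apply/funext => w; ring.
have p1 := L1Z u Zt; have p2 := L1Z v Zb; have p3 := L1B p1 p2.
by rewrite (ExD Zr p3) (ExB p1 p2) (ExZ _ Zt) (ExZ _ Zb) Ex_horner_orthogonal// add0r.
Qed.

(** Let q = q1 + i q2. Then s1 + i s2 = q (X - conj z), so (s1 + i s2) / D = q / (X - z), and q(z) =
    u + iv. The third hypothesis is the real part of q1(z)^2 + q2(z)^2 = -1; with the sign condition
    it gives |q(z)| >= 1. Cauchy-Schwarz for [Z] against each of s1 / D and s2 / D then bounds
    |q(z)|^2 (S^2 + S'^2). *)
Let kernel_bound_aux (q1 q2 r1 r2 : {poly R}) (m1 n1 m2 n2 : R) :
  q1 = Dp * r1 + (m1 *: ('X - a%:P) + n1%:P) ->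
  q2 = Dp * r2 + (m2 *: ('X - a%:P) + n2%:P) ->
  1 + n1 ^+ 2 + n2 ^+ 2 = b ^+ 2 * (m1 ^+ 2 + m2 ^+ 2) ->
  0 <= m1 * n2 - n1 * m2 ->
  S ^+ 2 <= kappa * Ex P (fun w => (q1 ^+ 2 + q2 ^+ 2).[Y w] / D (Y w)).
Proof.
move=> q1E q2E mn sgn.
pose u := n1 - b * m2; pose v := n2 + b * m1.
have uv : 1 <= u ^+ 2 + v ^+ 2.
  have -> : u ^+ 2 + v ^+ 2 = n1 ^+ 2 + n2 ^+ 2 + b ^+ 2 * (m1 ^+ 2 + m2 ^+ 2)
      + 2 * (b * (m1 * n2 - n1 * m2)) by rewrite /u /v; ring.
  rewrite -mn; have := mulr_ge0 (ltW b0) sgn.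
  by have := sqr_ge0 n1; have := sqr_ge0 n2; lra.
pose s1 : {poly R} := q1 * ('X - a%:P) - b *: q2.
pose s2 : {poly R} := q2 * ('X - a%:P) + b *: q1.
have E1 : Ex P (fun w => Z w * (s1.[Y w] / D (Y w))) = u * S' - v * S.
  rewrite -(Ex_frac (r1 * ('X - a%:P) - b *: r2 + m1%:P) u v).
  congr Ex; apply/funext => w; congr (_ * _).
  have D0 : D (Y w) != 0 by rewrite gt_eqF.
  apply: (mulIf D0); rewrite mulrDl !divfK//.
  rewrite /s1 q1E q2E !(hornerD, hornerN, hornerM, hornerZ, hornerX, hornerC) /u /v /D; ring.
have E2 : Ex P (fun w => Z w * (s2.[Y w] / D (Y w))) = v * S' - (- u) * S.
  rewrite -(Ex_frac (r2 * ('X - a%:P) + b *: r1 + m2%:P) v (- u)).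
  congr Ex; apply/funext => w; congr (_ * _).
  have D0 : D (Y w) != 0 by rewrite gt_eqF.
  apply: (mulIf D0); rewrite mulrDl !divfK//.
  rewrite /s2 q1E q2E !(hornerD, hornerN, hornerM, hornerZ, hornerX, hornerC) /u /v /D; ring.
have C1 := Ex_cauchy_schwarz Z2 (L2_frac s1).
have C2 := Ex_cauchy_schwarz Z2 (L2_frac s2).
rewrite E1 in C1; rewrite E2 in C2.
have -> : Ex P (fun w => (q1 ^+ 2 + q2 ^+ 2).[Y w] / D (Y w)) =
    Ex P (fun w => (s1.[Y w] / D (Y w)) ^+ 2) +
    Ex P (fun w => (s2.[Y w] / D (Y w)) ^+ 2).
  rewrite -ExD; [|exact: (L2_frac s1).2|exact: (L2_frac s2).2].
  congr Ex; apply/funext => w.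
  have D0 : D (Y w) != 0 by rewrite gt_eqF.
  rewrite /s1 /s2 !(hornerD, hornerN, hornerM, hornerZ, hornerX, hornerC); apply: (mulIf D0); apply: (mulIf D0).
  rewrite divfK// [in RHS]mulrDl [in RHS]mulrDl.
  have H (x : R) : (x / D (Y w)) ^+ 2 * D (Y w) * D (Y w) = x ^+ 2.
    by rewrite -mulrA -expr2 -exprMn divfK.
  by rewrite !H /D; ring.
rewrite mulrDr; apply: le_trans (lerD C1 C2).
have -> : (u * S' - v * S) ^+ 2 + (v * S' - - u * S) ^+ 2 =
  (u ^+ 2 + v ^+ 2) * (S ^+ 2 + S' ^+ 2) by ring.
have := sqr_ge0 S; have := sqr_ge0 S'; nra.
Qed.

Let size_Dp : size Dp = 3%N.
Proof.
by rewrite /Dp size_addl ?size_exp_XsubC// ltnS (leq_trans (size_polyC_leq1 _)).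
Qed.

Let reduce (q : {poly R}) : exists (r : {poly R}) (m n : R),
  q = Dp * r + (m *: ('X - a%:P) + n%:P).
Proof.
have Dp0 : Dp != 0 by rewrite -size_poly_gt0 size_Dp.
exists (q %/ Dp), (q %% Dp)`_1, ((q %% Dp)`_0 + (q %% Dp)`_1 * a).
rewrite {1}(divp_eq q Dp) mulrC; congr (_ + _).
have sr : (size (q %% Dp)%R <= 2)%N by rewrite -ltnS -size_Dp ltn_modp.
apply/polyP => i; rewrite coefD coefZ coefB coefX !coefC.
case: i => [|[|i]] /=; first by ring.
  by ring.
by rewrite nth_default ?(leq_trans sr)//; ring.
Qed.

(* A polynomial majorant [p] of [1/D] makes [p D - 1] nonnegative, hence a sum
   of two squares. *)
Lemma kernel_bound (p : {poly R}) : (forall x, (D x)^-1 <= p.[x]) ->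
  S ^+ 2 <= kappa * (Ex P (fun w => p.[Y w]) - Ex P (fun w => (D (Y w))^-1)).
Proof.
move=> pD.
have Q0 x : 0 <= (p * Dp - 1).[x].
  rewrite hornerD hornerN hornerM DpE hornerC subr_ge0 -ler_pdivrMr ?D_gt0// mul1r; exact: pD.
have [q1 [q2 qE]] := nonneg_poly_sum_two_squares Q0.
have [r1 [m1 [n1 q1E]]] := reduce q1; have [r2 [m2 [n2 q2E]]] := reduce q2.
have mn : 1 + n1 ^+ 2 + n2 ^+ 2 = b ^+ 2 * (m1 ^+ 2 + m2 ^+ 2).
  (* [K] collects all multiples of D in p D - 1 - q1^2 - q2^2 = 0. Then K D has degree at most 1,
     hence K = 0, and evaluation at [a] leaves the real part of q1(z)^2 + q2(z)^2 = -1. *)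
  pose K : {poly R} := p - (r1 * (Dp * r1 + 2 *: (m1 *: ('X - a%:P) + n1%:P))
     + r2 * (Dp * r2 + 2 *: (m2 *: ('X - a%:P) + n2%:P)))
     - (m1 ^+ 2 + m2 ^+ 2)%:P.
  pose c := 1 + n1 ^+ 2 + n2 ^+ 2 - b ^+ 2 * (m1 ^+ 2 + m2 ^+ 2).
  have KE : K * Dp = c%:P + (2 * (m1 * n1 + m2 * n2)) *: ('X - a%:P).
    have pDE : p * Dp = 1 + (q1 ^+ 2 + q2 ^+ 2) by rewrite -qE; ring.
    rewrite /K !mulrBl pDE q1E q2E /c /Dp.
    rewrite -!mul_polyC !(polyCD, polyCM, polyCB, polyC_exp, polyCN).
    ring.
  have K0 : K = 0.
    apply/eqP; apply: contraT => Kn0.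
    have : (size (K * Dp)%R <= 2)%N.
      rewrite KE (leq_trans (size_polyD _ _))// geq_max.
      rewrite (leq_trans (size_polyC_leq1 _))//= (leq_trans (size_scale_leq _ _))//.
      by rewrite size_XsubC.
    rewrite size_mul ?size_Dp//; last by rewrite -size_poly_gt0 size_Dp.
    by rewrite addn3 /= !ltnS leqn0 size_poly_eq0 (negbTE Kn0).
  have := congr1 (fun r => r.[a]) KE; rewrite K0 mul0r !hornerE subrr mulr0 addr0.
  by rewrite /c => H; lra.
have L1D : L1 P (fun w => (D (Y w))^-1).
  by have := L2_L1 (L2_frac 1); under eq_fun do rewrite hornerC mul1r.
have -> : Ex P (fun w => p.[Y w]) - Ex P (fun w => (D (Y w))^-1) =
    Ex P (fun w => (q1 ^+ 2 + q2 ^+ 2).[Y w] / D (Y w)).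
  rewrite -ExB//; last exact: L1_horner.
  congr Ex; apply/funext => w; rewrite -qE hornerD hornerN hornerM DpE hornerC.
  by rewrite mulrBl mulfK ?mul1r// gt_eqF// D_gt0.
(* The values of q1 + i q2 and q1 - i q2 at z have moduli with product 1; the sign tells which one
   is at least 1. *)
have [sgn|sgn] := leP 0 (m1 * n2 - n1 * m2).
  exact: (kernel_bound_aux q1E q2E mn sgn).
have -> : q1 ^+ 2 + q2 ^+ 2 = q1 ^+ 2 + (- q2) ^+ 2 by rewrite sqrrN.
have q2E' : - q2 = Dp * (- r2) + ((- m2) *: ('X - a%:P) + (- n2)%:P).
  by rewrite q2E polyCN scaleNr; ring.
by apply: (kernel_bound_aux q1E q2E'); rewrite ?sqrrN//; lra.
Qed.

Hypothesis determinate : forall nu : probability R R,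
  (forall n : nat, nu.-integrable setT (fun x => (x ^+ n)%:E) /\
     (\int[nu]_x (x ^+ n)%:E = \int[P]_w ((Y w) ^+ n)%:E)%E) ->
  forall B : set R, measurable B -> nu B = pushforward P Y B.

Lemma Ex_poisson_kernel_eq0 : S = 0.
Proof.
have L2b : L2 P (fun w => b / D (Y w)) by rewrite frac_cst; exact: L2_frac.
have [k0|kn0] := eqVneq kappa 0.
  have := Ex_cauchy_schwarz Z2 L2b; rewrite -/kappa -/S k0 mul0r => H.
  by apply/eqP; rewrite -sqrf_eq0 eq_le H sqr_ge0.
have k0 : 0 < kappa.
  by rewrite lt_def kn0; apply: Ex_ge0 => w; exact: sqr_ge0.
(* [del] is exactly the gap that [kernel_bound] leaves between E (1/D)(Y) and E p(Y) for every
   polynomial majorant p of 1/D. *)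
pose f (x : R) := (D x)^-1; pose del := S ^+ 2 / kappa.
have del0 : 0 <= del by rewrite divr_ge0 ?sqr_ge0// ltW.
have L1f : L1 P (fun w => f (Y w)).
  by have := L2_L1 (L2_frac 1); under eq_fun do rewrite hornerC mul1r.
pose l (p : {poly R}) := Ex P (fun w => p.[Y w]).
pose tau := Ex P (fun w => f (Y w)) + del.
have lD p q : l (p + q) = l p + l q.
  rewrite /l -ExD; [|exact: L1_horner|exact: L1_horner].
  by congr Ex; apply/funext => w; rewrite hornerD.
have lZ t p : l (t *: p) = t * l p.
  rewrite /l -ExZ; last exact: L1_horner.
  by congr Ex; apply/funext => w; rewrite hornerZ.
have pf : polydom f by exact: polydom_bounded Dinv_le.
(* For c < 0, p / (- c) majorises 1/D and [kernel_bound] applies; for c >= 0, raising the value of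
   [f] by [del] preserves positivity. *)
have lpos p c : (forall x, 0 <= p.[x] + c * f x) -> 0 <= l p + c * tau.
  move=> pc; have [c0|c0] := leP 0 c.
    rewrite /tau mulrDr addrA; apply: addr_ge0; last exact: mulr_ge0.
    rewrite /l -ExZ// -ExD; [|exact: L1_horner|exact: L1Z].
    by apply: Ex_ge0.
  have cV : 0 < - c by rewrite oppr_gt0.
  have /kernel_bound : forall x, (D x)^-1 <= ((- c)^-1 *: p).[x].
    move=> x; rewrite hornerZ ler_pdivlMl//.
    by have := pc x; rewrite /f; lra.
  have := lZ (- c)^-1 p; rewrite {1}/l => ->.
  rewrite -ler_pdivrMl// => H.
  have : tau <= (- c)^-1 * l p.
    by rewrite /tau /del mulrC in H *; move: H; rewrite /f; lra.
  rewrite ler_pdivlMl// mulNr; lra.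
have [L [Llin Lpos LE]] := positive_extension lD lZ pf lpos.
have Lp (p : {poly R}) : L (horner p) = l p.
  rewrite -[RHS]addr0 -[X in _ + X](mul0r tau) -LE; congr L.
  by apply/funext => x; rewrite mul0r addr0.
have Lunit : L (fun=> 1) = 1.
  have -> : (fun=> 1) = horner 1 :> (R -> R) by apply/funext => x; rewrite hornerC.
  by rewrite Lp /l; under eq_fun do rewrite hornerC; exact: Ex_cst.
have [nu nuL] := positive_functional_probability Llin Lpos Lunit.
have cD : continuous f.
  move=> x; apply: cvgV; first by rewrite gt_eqF// D_gt0.
  have -> : D = horner Dp by apply/funext => y; rewrite DpE.
  exact: continuous_horner.
have nuY : forall B : set R, measurable B -> nu B = pushforward P Y B.
  apply: determinate => n.
  have [|| n1 n2] := nuL (horner 'X^n).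
  - exact: continuous_horner.
  - exact: polydom_poly.
  have E : horner 'X^n = (fun x => x ^+ n) :> (R -> R).
    by apply/funext => x; rewrite hornerXn.
  rewrite E in n1 n2; split; first exact: n1.
  rewrite (integral_Ex n1) n2 (integral_Ex (Y1 n)) -E Lp /l.
  by congr (Ex _ _)%:E; apply/funext => w; rewrite hornerXn.
(* By determinacy [nu] is the law of [Y], yet it integrates [f] to [tau], which exceeds E f(Y) by
   [del]; so [del] = 0. *)
have [nf1 nf2] := nuL f cD pf.
have : Ex nu f = Ex P (fun w => f (Y w)).
  rewrite /Ex /Rintegral; congr fine.
  rewrite (eq_measure_integral (pushforward P Y)); last first.
    by move=> A mA _; exact: nuY.
  rewrite ge0_integral_pushforward//.
  - apply/measurable_EFinP; exact: continuous_measurable_fun.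
  - by move=> x _; rewrite lee_fin invr_ge0 ltW.
have Lf : L f = tau.
  have := LE 0 1; rewrite mul1r.
  have -> : l 0 = 0 by have := lZ 0 0; rewrite scale0r mul0r.
  rewrite add0r => <-; congr L; apply/funext => x.
  by rewrite horner0 add0r mul1r.
rewrite nf2 Lf /tau => H.
have : del = 0 by lra.
by move/eqP; rewrite mulf_eq0 invr_eq0 (negbTE kn0) orbF sqrf_eq0 => /eqP.
Qed.

End kernel.

(* M. Riesz: polynomials are dense in L2 of a determinate law. *)
Theorem determinate_orthogonal (Z : T -> R) :
  (forall nu : probability R R,
    (forall n : nat, nu.-integrable setT (fun x => (x ^+ n)%:E) /\
       (\int[nu]_x (x ^+ n)%:E = \int[P]_w ((Y w) ^+ n)%:E)%E) ->
    forall B : set R, measurable B -> nu B = pushforward P Y B) ->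
  L2 P Z -> (forall n, Ex P (fun w => Z w * Y w ^+ n) = 0) ->
  forall B, measurable B -> Ex P (fun w => Z w * \1_(Y @^-1` B) w) = 0.
Proof.
move=> det Z2 ZY; apply: Ex_poisson_inversion => //.
- exact: L2_L1.
- by rewrite -[RHS](ZY 0%N); congr Ex; apply/funext => w; rewrite expr0 mulr1.
- by move=> a b b0; exact: (Ex_poisson_kernel_eq0 a Z2 ZY b0 det).
Qed.

End riesz.

(** * Conditional expectations *)

Section sigma_gen.
Context (R : realType) (d : measure_display) (T : measurableType d).
Implicit Types (X : R -> T -> R) (J : set R) (f g : T -> R).

(** Reads [G_measurable] as measurability on the type carrying the generated sigma-algebra, which
    brings in the usual closure properties. *)
Lemma G_measurableP (C : set (set T)) f :
  G_measurable <<s C >> f <->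
  measurable_fun (setT : set (g_sigma_algebraType C)) f.
Proof.
split=> [mf _ B mB|mf B mB]; first by rewrite setTI; exact: mf.
by rewrite -[X in <<s _ >> X]setTI; exact: mf.
Qed.

Lemma G_measurableD (C : set (set T)) f g : G_measurable <<s C >> f ->
  G_measurable <<s C >> g -> G_measurable <<s C >> (fun w => f w + g w).
Proof.
move=> /G_measurableP mf /G_measurableP mg; apply/G_measurableP.
exact: measurable_funD.
Qed.

Lemma G_measurableM (C : set (set T)) f g : G_measurable <<s C >> f ->
  G_measurable <<s C >> g -> G_measurable <<s C >> (fun w => f w * g w).
Proof.
move=> /G_measurableP mf /G_measurableP mg; apply/G_measurableP.
exact: measurable_funM.
Qed.

Lemma G_measurable_cst (C : set (set T)) (k : R) :
  G_measurable <<s C >> (fun=> k).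
Proof. by apply/G_measurableP; exact: measurable_cst. Qed.

Lemma G_measurable_indic (C : set (set T)) (A : set T) :
  <<s C >> A -> G_measurable <<s C >> (\1_A : T -> R).
Proof.
by move=> CA; apply/G_measurableP;
  exact: (@measurable_indic _ (g_sigma_algebraType C)).
Qed.

Lemma G_measurable_comp (C : set (set T)) (phi : R -> R) f :
  measurable_fun setT phi -> G_measurable <<s C >> f ->
  G_measurable <<s C >> (fun w => phi (f w)).
Proof.
move=> mphi /G_measurableP mf; apply/G_measurableP.
exact: measurableT_comp mf.
Qed.

Lemma G_measurable_sub (G G' : set (set T)) f : G `<=` G' ->
  G_measurable G f -> G_measurable G' f.
Proof. by move=> GG' mf B mB; apply/GG'/mf. Qed.

Lemma sigma_gen_measurable X J :
  (forall v, J v -> measurable_fun setT (X v)) ->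
  sigma_gen X J `<=` measurable.
Proof.
move=> mX; apply: smallest_sub; first exact: sigma_algebra_measurable.
move=> _ [v [B [Jv [mB ->]]]]; rewrite -[X in measurable X]setTI.
exact: mX.
Qed.

Lemma sigma_gen_le X J J' : J `<=` J' -> sigma_gen X J `<=` sigma_gen X J'.
Proof.
move=> JJ'; apply: smallest_sub; first exact: smallest_sigma_algebra.
move=> A [v [B [Jv [mB ->]]]]; apply: sub_sigma_algebra.
by exists v, B; split; [exact: JJ'|].
Qed.

Lemma sigma_gen_coord X J v : J v -> G_measurable (sigma_gen X J) (X v).
Proof. by move=> Jv B mB; apply: sub_sigma_algebra; exists v, B. Qed.

Lemma sigma_gen1 X v A : sigma_gen X [set v] A ->
  exists2 B, measurable B & A = X v @^-1` B.
Proof.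
pose S := [set A | exists2 B, measurable B & A = X v @^-1` B].
suff : sigma_gen X [set v] `<=` S by apply.
apply: smallest_sub; last by move=> _ [_ [B [-> [mB ->]]]]; exists B.
split.
- by exists set0; [exact: measurable0|rewrite preimage_set0].
- move=> _ [B mB ->]; exists (~` B); first exact: measurableC.
  by rewrite setTD preimage_setC.
- move=> F SF.
  have /choice[B BP] : forall n, exists B, measurable B /\ F n = X v @^-1` B.
    by move=> n; have [B mB FB] := SF n; exists B.
  exists (\bigcup_n B n); first by apply: bigcup_measurable => n _; exact: (BP n).1.
  by rewrite preimage_bigcup; apply: eq_bigcupr => n _; rewrite (BP n).2.
Qed.

End sigma_gen.

Section conditional_expectation.
Context (R : realType) (d : measure_display) (T : measurableType d)
  (P : probability T R) (C : set (set T)).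
Hypothesis Cm : <<s C >> `<=` measurable.
Implicit Types (f g h : T -> R).

Lemma G_measurable_measurable f :
  G_measurable <<s C >> f -> measurable_fun setT f.
Proof. by move=> mf _ B mB; rewrite setTI; apply: Cm; exact: mf. Qed.

Lemma cond_exp_indic f g A : L1 P f -> is_cond_exp P <<s C >> f g ->
  <<s C >> A -> Ex P (fun w => f w * \1_A w) = Ex P (fun w => g w * \1_A w).
Proof.
move=> f1 [mg g1 fg] CA; have mA := Cm CA.
have := fg A CA; rewrite (integral_indic_Ex mA g1) (integral_indic_Ex mA f1).
by move=> [->].
Qed.

Lemma cond_exp_pull_out f g h : L1 P f -> is_cond_exp P <<s C >> f g ->
  G_measurable <<s C >> h -> L1 P (fun w => f w * h w) ->
  L1 P (fun w => g w * h w) ->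
  Ex P (fun w => f w * h w) = Ex P (fun w => g w * h w).
Proof.
move=> f1 fg mh fh gh; have [_ g1 _] := fg.
apply/eqP; rewrite -subr_eq0 -ExB//.
have E : (fun w => f w * h w - g w * h w) = (fun w => (f w - g w) * h w).
  by apply/funext => w; rewrite mulrBl.
rewrite E; apply/eqP; apply: Ex_pull_out.
- exact: L1B.
- exact: G_measurable_measurable.
- move=> B mB; have CB : <<s C >> (h @^-1` B) by exact: mh.
  under eq_fun do rewrite mulrBl.
  rewrite ExB; [|exact: L1_indic (Cm CB) f1|exact: L1_indic (Cm CB) g1].
  by rewrite (cond_exp_indic f1 fg CB) subrr.
- by rewrite -E; exact: L1B.
Qed.

Definition clamp01 (x : R) : R := Num.max 0 (Num.min x 1).

Lemma measurable_clamp01 : measurable_fun setT clamp01.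
Proof. by apply: measurable_maxr => //; exact: measurable_minr. Qed.

Lemma clamp01_bounded x : `|clamp01 x| <= 1.
Proof.
rewrite ger0_norm /clamp01; last by rewrite le_max lexx.
by rewrite ge_max ler01 ge_min lexx orbT.
Qed.

(** A version of a conditional probability lies in [0, 1] only almost surely. Testing on the parts
    of [B] where g > 1 and where g < 0 shows that truncation changes no integral; the bounded
    version can then be multiplied by any integrable variable. *)
Lemma cond_exp_clamp01 A g B : measurable A ->
  is_cond_exp P <<s C >> (\1_A) g -> <<s C >> B ->
  Ex P (fun w => \1_A w * \1_B w) = Ex P (fun w => clamp01 (g w) * \1_B w).
Proof.
move=> mA Ag CB; have [mg g1 _] := Ag.
have A1 : L1 P (\1_A) by exact: integrable_indic.
have [mB cg1] : measurable B /\ L1 P (fun w => clamp01 (g w)).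
  split; first exact: Cm.
  apply: (@L1_bounded _ _ _ _ _ 1); last by move=> w; exact: clamp01_bounded.
  by apply: measurableT_comp measurable_clamp01 _; exact: G_measurable_measurable.
rewrite (cond_exp_indic A1 Ag CB).
pose B1 := B `&` g @^-1` `]1, +oo[%classic.
pose B2 := B `&` g @^-1` `]-oo, 0[%classic.
have CI A1' A2' : <<s C >> A1' -> <<s C >> A2' -> <<s C >> (A1' `&` A2').
  exact: (@measurableI _ (g_sigma_algebraType C)).
have CB1 : <<s C >> B1 by apply: CI => //; apply: mg; exact: measurable_itv.
have CB2 : <<s C >> B2 by apply: CI => //; apply: mg; exact: measurable_itv.
have mB1 := Cm CB1; have mB2 := Cm CB2.
have H1 : Ex P (fun w => (g w - 1) * \1_B1 w) = 0.
  apply/eqP; rewrite eq_le; apply/andP; split; last first.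
    apply: Ex_ge0 => w; rewrite indicE; have [|_] := boolP (w \in B1); last by rewrite mulr0.
    by rewrite inE => -[_]; rewrite /= in_itv/= andbT mulr1 subr_ge0 => /ltW.
  have -> : (fun w => (g w - 1) * \1_B1 w) = (fun w => g w * \1_B1 w - 1 * \1_B1 w).
    by apply/funext => w; rewrite mulrBl.
  rewrite ExB; [|exact: L1_indic|by apply: L1_indic => //; exact: L1_cst].
  rewrite -(cond_exp_indic A1 Ag CB1) subr_le0; apply: Ex_le.
  - exact: L1_indic.
  - by apply: L1_indic => //; exact: L1_cst.
  - by move=> w; rewrite ler_wpM2r ?indicE ?ler0n// lern1 leq_b1.
have H2 : Ex P (fun w => g w * \1_B2 w) = 0.
  apply/eqP; rewrite eq_le; apply/andP; split; last first.
    rewrite -(cond_exp_indic A1 Ag CB2); apply: Ex_ge0 => w.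
    by rewrite mulr_ge0// indicE ler0n.
  rewrite -oppr_ge0 -mulN1r -ExZ; last exact: L1_indic.
  apply: Ex_ge0 => w; rewrite indicE; have [|_] := boolP (w \in B2); last by rewrite !mulr0.
  by rewrite inE => -[_]; rewrite /= in_itv/= mulr1 mulN1r oppr_ge0 => /ltW.
have E : (fun w => g w * \1_B w) = (fun w => clamp01 (g w) * \1_B w +
    ((g w - 1) * \1_B1 w + g w * \1_B2 w)).
  apply/funext => w; rewrite !indicE !in_setI.
  case: (boolP (w \in B)) => wB /=; last by rewrite !mulr0 !addr0.
  have -> : (w \in g @^-1` `]1, +oo[%classic) = (1 < g w).
    by apply/idP/idP; rewrite inE/= in_itv/= andbT.
  have -> : (w \in g @^-1` `]-oo, 0[%classic) = (g w < 0).
    by apply/idP/idP; rewrite inE/= in_itv.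
  rewrite /clamp01; have [g1'|g1'] := ltP 1 (g w).
    rewrite (max_r ler01) ltNge (le_trans ler01 (ltW g1')) /=.
    by ring.
  by have [g0|g0] := ltP (g w) 0; rewrite /=; ring.
rewrite E ExD; [|exact: L1_indic|]; last first.
  apply: L1D; last exact: L1_indic.
  by apply: L1_indic => //; apply: L1B => //; exact: L1_cst.
rewrite ExD; [|by apply: L1_indic => //; apply: L1B => //; exact: L1_cst|exact: L1_indic].
by rewrite H1 H2 !addr0.
Qed.

End conditional_expectation.

(** * The Markov property for the whole future *)

Section markov_cylinders.
Context (R : realType) (d : measure_display) (T : measurableType d)
  (P : probability T R) (I : set R) (X : R -> T -> R).
Hypothesis mX : forall t, I t -> measurable_fun setT (X t).
Hypothesis XM : Defs.markov P I X.

Lemma F_le_measurable s : F_le I X s `<=` measurable.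
Proof. by apply: sigma_gen_measurable => v [Iv _]; exact: mX. Qed.

Lemma F_le_le s t : s <= t -> F_le I X s `<=` F_le I X t.
Proof.
by move=> st; apply: sigma_gen_le => v [Iv vs]; split=> //; exact: le_trans st.
Qed.

Lemma F_le_coord s v : I v -> v <= s -> G_measurable (F_le I X s) (X v).
Proof. by move=> Iv vs; exact: sigma_gen_coord. Qed.

Lemma F_le_preimage s v B : I v -> v <= s -> measurable B ->
  F_le I X s (X v @^-1` B).
Proof. by move=> Iv vs mB; exact: F_le_coord. Qed.

Let mXB v B : I v -> measurable B -> measurable (X v @^-1` B).
Proof. by move=> Iv mB; rewrite -[X in measurable X]setTI; exact: mX. Qed.

(** For [xi] depending on the past of [v], this says E(xi | X v) = 0 without choosing a version. *)
Definition invisible (v : R) (xi : T -> R) :=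
  [/\ G_measurable (F_le I X v) xi, L1 P xi &
    forall B, measurable B -> Ex P (fun w => xi w * \1_(X v @^-1` B) w) = 0].

(** Markov property: [xi] and the indicator of X v' in B have the product expectation E(xi P(X v' in
    B | X v)), and the conditional probability is a function of [X v], to which [xi] is
    orthogonal. *)
Lemma invisible_le v v' xi : I v -> I v' -> v <= v' ->
  invisible v xi -> invisible v' xi.
Proof.
move=> Iv Iv' vv' [mxi xi1 xi0]; split=> //.
  by apply: G_measurable_sub mxi; exact: F_le_le.
move=> B mB; have [Z [mZ ZB]] := XM Iv Iv' vv' mB.
have Fm := @F_le_measurable v.
have mA := mXB Iv' mB.
have mZT : measurable_fun setT Z.
  by case: ZB => + _ _; exact: G_measurable_measurable.
pose Z' w := clamp01 (Z w).
have mZ' : measurable_fun setT Z'.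
  exact: (measurableT_comp (@measurable_clamp01 R) mZT).
have Z'b w : `|Z' w| <= 1 by exact: clamp01_bounded.
have Z'1 : L1 P Z' by exact: L1_bounded Z'b.
have A1 : L1 P (\1_(X v' @^-1` B)) by exact: integrable_indic.
have xiA : L1 P (fun w => xi w * \1_(X v' @^-1` B) w) by exact: L1_indic.
have xiZ : L1 P (fun w => xi w * Z' w) by exact: (@L1M _ _ _ _ _ 1).
have -> : Ex P (fun w => xi w * \1_(X v' @^-1` B) w) = Ex P (fun w => xi w * Z' w).
  apply/eqP; rewrite -subr_eq0 -ExB//.
  have E : (fun w => xi w * \1_(X v' @^-1` B) w - xi w * Z' w) =
      (fun w => (\1_(X v' @^-1` B) w - Z' w) * xi w).
    by apply/funext => w; rewrite -mulrBr mulrC.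
  rewrite E; apply/eqP; apply: Ex_pull_out.
  - exact: L1B.
  - exact: G_measurable_measurable mxi.
  - move=> D mD; have FD : F_le I X v (xi @^-1` D) by exact: mxi.
    under eq_fun do rewrite mulrBl.
    rewrite ExB; [|exact: L1_indic (Fm _ FD) A1|exact: L1_indic (Fm _ FD) Z'1].
    by rewrite (cond_exp_clamp01 Fm mA ZB FD) subrr.
  - by rewrite -E; exact: L1B.
apply: Ex_pull_out => // D mD.
have mZ'1 : G_measurable (sigma_gen X [set v]) Z'.
  exact: G_measurable_comp (@measurable_clamp01 R) mZ.
have [D' mD' ->] := sigma_gen1 (mZ'1 D mD).
exact: xi0.
Qed.

Lemma invisible_indic v xi B : I v -> measurable B -> invisible v xi ->
  invisible v (fun w => xi w * \1_(X v @^-1` B) w).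
Proof.
move=> Iv mB [mxi xi1 xi0]; split.
- by apply: G_measurableM => //; apply: G_measurable_indic; exact: F_le_preimage.
- by apply: L1_indic => //; exact: mXB.
- move=> D mD; rewrite -(xi0 (B `&` D) (measurableI _ _ mB mD)).
  by congr Ex; apply/funext => w; rewrite preimage_setI indicI -mulrA.
Qed.

(** Coordinates come in increasing order of time, so that the Markov property can be applied to one
    factor after another. *)
Inductive cylinder : R -> set T -> Prop :=
| cylinderT v : cylinder v setT
| cylinderI v v' B A : I v' -> v <= v' -> measurable B -> cylinder v' A ->
    cylinder v (X v' @^-1` B `&` A).

(** The merge of two lists sorted by time, hence the nested induction. *)
Lemma cylinder_setI v : setI_closed (cylinder v).
Proof.
move=> A A' cA; elim: cA A' => {v A} [v A'|v a B A Ia va mB cA IH A' cA'].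
  by rewrite setTI.
have {va} : v <= a by [].
elim: cA' => {v A'} [v va|v a' B' A' Ia' va' mB' cA' IH' va].
  by rewrite setIT; exact: cylinderI.
have [aa'|a'a] := leP a a'.
  by rewrite -setIA; apply: cylinderI => //; apply: IH; exact: cylinderI.
rewrite setICA; apply: cylinderI => //; exact/IH'/ltW.
Qed.

Lemma cylinder_measurable v A : cylinder v A -> measurable A.
Proof.
elim=> {v A} [v|v a B A Ia _ mB _ mA]; first exact: measurableT.
by apply: measurableI => //; exact: mXB.
Qed.

(** Move [xi] forward to the time of the first factor, where it stays invisible, absorb the
    indicator of that factor and continue. *)
Lemma invisible_cylinder v A : cylinder v A -> forall xi, I v ->
  invisible v xi -> Ex P (fun w => xi w * \1_A w) = 0.
Proof.
elim=> {v A} [v xi Iv [_ _ xi0]|v a B A Ia va mB _ IH xi Iv xiv].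
  by rewrite -[RHS](xi0 setT)// preimage_setT.
rewrite -[RHS](IH (fun w => xi w * \1_(X a @^-1` B) w))//; last first.
  by apply: invisible_indic => //; exact: (invisible_le Iv).
by congr Ex; apply/funext => w; rewrite indicI -mulrA.
Qed.

Lemma invisible_future v xi A : I v -> invisible v xi ->
  sigma_gen X [set v' | I v' /\ v <= v'] A ->
  Ex P (fun w => xi w * \1_A w) = 0.
Proof.
move=> Iv xiv FA; have [_ xi1 _] := xiv.
have xi0 : Ex P xi = 0.
  rewrite -[RHS](invisible_cylinder (cylinderT v) Iv xiv).
  by congr Ex; apply/funext => w; rewrite indicT mulr1.
have cA : <<s cylinder v >> A.
  move: A FA; apply: smallest_sub; first exact: smallest_sigma_algebra.
  move=> _ [v' [B [[Iv' vv'] [mB ->]]]]; apply: sub_sigma_algebra.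
  by rewrite -[X in cylinder _ X]setIT; apply: cylinderI => //; exact: cylinderT.
have [] := Ex_pi_lambda xi1 xi0 (@cylinder_setI v) _ _ cA => //.
- by move=> D; exact: cylinder_measurable.
- by move=> D cD; exact: (invisible_cylinder cD Iv xiv).
Qed.

(* The past up to [s] and the future from [u] generate [F_out s u]. *)
Lemma F_out_eq0 s u W : I s -> I u -> s < u ->
  G_measurable (F_le I X u) W -> L1 P W ->
  (forall A B, F_le I X s A -> measurable B ->
     Ex P (fun w => W w * \1_A w * \1_(X u @^-1` B) w) = 0) ->
  forall A, F_out I X s u A -> Ex P (fun w => W w * \1_A w) = 0.
Proof.
move=> Is Iu su mW W1 W0 A FA.
pose Fu := sigma_gen X [set v' | I v' /\ u <= v'].
pose C := [set A | exists A1 A2, [/\ F_le I X s A1, Fu A2 & A = A1 `&` A2]].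
have Fum : Fu `<=` measurable.
  by apply: sigma_gen_measurable => v [Iv _]; exact: mX.
have FsT : F_le I X s setT by exact: (@measurableT _ (g_sigma_algebraType _)).
have FuT : Fu setT by exact: (@measurableT _ (g_sigma_algebraType _)).
have CI : setI_closed C.
  move=> _ _ [A1 [A2 [FA1 FA2 ->]]] [B1 [B2 [FB1 FB2 ->]]].
  exists (A1 `&` B1), (A2 `&` B2); split; last by rewrite setIACA.
  - exact: (@measurableI _ (g_sigma_algebraType _)).
  - exact: (@measurableI _ (g_sigma_algebraType _)).
have Cm D : C D -> measurable D.
  move=> [A1 [A2 [FA1 FA2 ->]]]; apply: measurableI; last exact: Fum.
  exact: F_le_measurable FA1.
have CW D : C D -> Ex P (fun w => W w * \1_D w) = 0.
  move=> [A1 [A2 [FA1 FA2 ->]]].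
  (* [W] restricted to a past event is invisible at [u], so it is orthogonal to the whole future of
     [u]. *)
  have inv : invisible u (fun w => W w * \1_A1 w).
    split; last by move=> B mB; exact: W0.
    - apply: G_measurableM => //; apply: G_measurable_indic.
      exact: F_le_le (ltW su) _ FA1.
    - by apply: L1_indic => //; exact: F_le_measurable FA1.
  rewrite -[RHS](invisible_future Iu inv FA2).
  by congr Ex; apply/funext => w; rewrite indicI -mulrA.
have WE : Ex P W = 0.
  rewrite -[RHS](CW setT); last by exists setT, setT; rewrite setIT.
  by congr Ex; apply/funext => w; rewrite indicT mulr1.
have CA : <<s C >> A.
  move: A FA; apply: smallest_sub; first exact: smallest_sigma_algebra.
  move=> _ [v [B [[Iv vsu] [mB ->]]]]; apply: sub_sigma_algebra.
  have [vs|sv] := leP v s.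
    exists (X v @^-1` B), setT; split=> //; last by rewrite setIT.
    exact: F_le_preimage.
  have uv : u <= v.
    by rewrite leNgt; apply/negP => vu; apply: vsu; rewrite sv.
  exists setT, (X v @^-1` B); split=> //; last by rewrite setTI.
  by apply: sub_sigma_algebra; exists v, B.
by have [] := Ex_pi_lambda W1 WE CI Cm CW CA.
Qed.

End markov_cylinders.

(** * Orthogonal polynomial martingales *)

Lemma finite_roots (R : realType) (p : {poly R}) :
  p != 0 -> finite_set [set x | root p x].
Proof.
move: {2}(size p) (leqnn (size p)) => n; elim: n p => [|n IH] p sp p0.
  by move: sp; rewrite leqn0 size_poly_eq0 (negbTE p0).
have [[r pr]|nr] := pselect (exists r, root p r); last first.
  rewrite (_ : [set x | root p x] = set0); first exact: finite_set0.
  by apply/seteqP; split=> // x px; apply: nr; exists x.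
have /factor_theorem[q pE] := pr.
have q0 : q != 0 by apply: contraNneq p0 => q0; rewrite pE q0 mul0r.
apply: (@sub_finite_set _ _ ([set r] `|` [set x | root q x])).
  move=> x /=; rewrite pE rootM root_XsubC => /orP[|/eqP]; first by right.
  by left.
rewrite finite_setU; split; first exact: finite_set1.
apply: IH => //; move: sp; rewrite pE size_mul ?polyXsubC_eq0//.
by rewrite size_XsubC addn2.
Qed.

Lemma poly_graded_eq0 (R : fieldType) (l : {poly R} -> R)
    (b : nat -> {poly R}) : (forall n, size (b n) = n.+1) ->
  (forall r s, l (r + s) = l r + l s) -> (forall t r, l (t *: r) = t * l r) ->
  (forall n, l (b n) = 0) -> forall r, l r = 0.
Proof.
move=> sb lD lZ lb r; move: {2}(size r) (leqnn (size r)) => n.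
elim: n r => [|n IH] r sr.
  move: sr; rewrite leqn0 size_poly_eq0 => /eqP->.
  by have := lZ 0 0; rewrite scale0r mul0r.
pose c := r`_n / (b n)`_n.
have bn0 : (b n)`_n != 0.
  have -> : (b n)`_n = lead_coef (b n) by rewrite lead_coefE sb.
  by rewrite lead_coef_eq0 -size_poly_gt0 sb.
have -> : r = (r - c *: b n) + c *: b n by rewrite subrK.
rewrite lD lZ lb mulr0 addr0; apply: IH.
apply/leq_sizeP => j nj; rewrite coefB coefZ.
move: nj; rewrite leq_eqVlt => /predU1P[<-|nj].
  by rewrite /c divfK// subrr.
by rewrite !nth_default ?mulr0 ?subrr ?sb// (leq_trans sr).
Qed.

Section opm.
Context (R : realType) (d : measure_display) (T : measurableType d)
  (P : probability T R) (I : set R) (X : R -> T -> R)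
  (p : nat -> R -> {poly R}) (alpha beta gamma phat : nat -> R -> R).
Hypothesis mX : forall t, I t -> measurable_fun setT (X t).
Hypothesis X1 : forall t n, I t -> L1 P (fun w => X t w ^+ n).
Hypothesis Xinf : forall t, I t -> ~ finite_set (Defs.support P X t).
Hypothesis sz : forall n t, I t -> size (p n t) = n.+1.
Hypothesis p0 : forall t, I t -> p 0%N t = 1.

Let q n t w : R := (p n t).[X t w].

Hypothesis orth : forall n m t, I t ->
  Ex P (fun w => q n t w * q m t w) = phat n t * (n == m)%:R.
Hypothesis mart : forall n s t, I s -> I t -> s <= t ->
  is_cond_exp P (F_le I X s) (q n t) (q n s).
Hypothesis rec : forall (n : nat) t, I t ->
  'X * p n t = alpha n.+1 t *: p n.+1 t + beta n t *: p n t
                + (if n is k.+1 then gamma k t *: p k t else 0).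

Let L2h t (r : {poly R}) : I t -> L2 P (fun w => r.[X t w]).
Proof. by move=> It; apply: L2_horner => // n; exact: X1. Qed.

Let L2q n t : I t -> L2 P (q n t).
Proof. exact: L2h. Qed.

Let L1q n t : I t -> L1 P (q n t).
Proof. by move=> It; exact: L2_L1 (L2q n It). Qed.

Let L2X t : I t -> L2 P (X t).
Proof.
move=> It; have := L2h 'X It; congr (L2 P); apply/funext => w.
by rewrite hornerX.
Qed.

Let L2hh s t (r r' : {poly R}) : I s -> I t ->
  L2 P (fun w => r.[X s w] * r'.[X t w]).
Proof.
move=> Is It; split; first exact: measurable_funM (L2h r Is).1 (L2h r' It).1.
have := L2M (L2h (r ^+ 2) Is) (L2h (r' ^+ 2) It).
by congr L1; apply/funext => w; rewrite !horner_exp exprMn.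
Qed.

Let mh (r : {poly R}) : measurable_fun setT (horner r).
Proof. by apply: continuous_measurable_fun; exact: continuous_horner. Qed.

Let G_horner (J : set R) t (r : {poly R}) : J t ->
  G_measurable (sigma_gen X J) (fun w => r.[X t w]).
Proof. by move=> Jt; apply: G_measurable_comp (mh r) _; exact: sigma_gen_coord. Qed.

Let Fm s : F_le I X s `<=` measurable.
Proof. exact: F_le_measurable. Qed.

(** The coefficient of p_n in the expansion of x p_m at time [t], an entry of the Jacobi matrix. The
    harness relation becomes linear in these matrices. *)
Definition jacobi n m t : R :=
  alpha m.+1 t * (n == m.+1)%:R + beta m t * (n == m)%:R
  + (if m is k.+1 then gamma k t * (n == k)%:R else 0).

Let Xq m t w : I t -> X t w * q m t w =
  alpha m.+1 t * q m.+1 t w + beta m t * q m t w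
  + (if m is k.+1 then gamma k t * q k t w else 0).
Proof.
move=> It; have := congr1 (fun r => r.[X t w]) (rec m It).
rewrite hornerM hornerX /q => ->; rewrite !hornerD !hornerZ.
by case: m => [|k]; rewrite ?hornerC ?hornerZ.
Qed.

Lemma Ex_pair n m s t : I s -> I t -> s <= t ->
  Ex P (fun w => q m t w * q n s w) = phat n s * (n == m)%:R.
Proof.
move=> Is It st; rewrite -orth// (cond_exp_pull_out (@Fm s) (L1q m It) (mart m Is It st)).
- by congr Ex; apply/funext => w; rewrite mulrC.
- exact: G_horner.
- by apply: L2M; exact: L2q.
- by apply: L2M; exact: L2q.
Qed.

(** The recurrence is used at time [t]; the martingale property then carries each p_k back to time
    [s], where orthogonality applies. Hence coefficients of time [t] with a norm of time [s]. *)
Lemma Ex_mulX n m s t : I s -> I t -> s <= t ->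
  Ex P (fun w => X t w * q m t w * q n s w) = jacobi n m t * phat n s.
Proof.
move=> Is It st.
have L k : L1 P (fun w => q k t w * q n s w) by apply: L2M; exact: L2q.
have -> : (fun w => X t w * q m t w * q n s w) =
    (fun w => alpha m.+1 t * (q m.+1 t w * q n s w)
            + beta m t * (q m t w * q n s w)
            + (if m is k.+1 then gamma k t * (q k t w * q n s w) else 0)).
  apply/funext => w; rewrite Xq//; case: m => [|k]; ring.
have H1 := L1Z (alpha m.+1 t) (L m.+1); have H2 := L1Z (beta m t) (L m).
have H3 := L1D H1 H2.
have [H4 E4] : L1 P (fun w => if m is k.+1 then gamma k t * (q k t w * q n s w) else 0) /\
    Ex P (fun w => if m is k.+1 then gamma k t * (q k t w * q n s w) else 0) =
    (if m is k.+1 then gamma k t * (n == k)%:R else 0) * phat n s.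
  case: {H1 H2 H3} m => [|k]; first by split; [exact: L1_cst|rewrite Ex_cst mul0r].
  split; first exact: L1Z (L k).
  by rewrite (ExZ _ (L k)) Ex_pair//; ring.
rewrite (ExD H3 H4) E4 (ExD H1 H2) (ExZ _ (L m.+1)) (ExZ _ (L m)) !Ex_pair//.
rewrite /jacobi !mulrDl; congr (_ + _ + _).
all: by rewrite mulrCA mulrC -!mulrA ?(mulrC (phat _ _)).
Qed.

(** Projecting [q m u] on the past of [v] reduces to [Ex_mulX]. Neither [u] nor the position of [v]
    in [s, u] affects the norm on the right, so the relation between three times can be divided by
    it. *)
Lemma Ex_mulX_between n m s v u : I s -> I v -> I u -> s <= v -> v <= u ->
  Ex P (fun w => X v w * (q n s w * q m u w)) = jacobi n m v * phat n s.
Proof.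
move=> Is Iv Iu sv vu; rewrite -(Ex_mulX n m Is Iv sv).
have L2Xq : L2 P (fun w => X v w * q n s w).
  have := L2hh 'X (p n s) Iv Is; congr (L2 P); apply/funext => w.
  by rewrite hornerX.
have -> : (fun w => X v w * (q n s w * q m u w)) =
    (fun w => q m u w * (X v w * q n s w)) by apply/funext => w; ring.
rewrite (cond_exp_pull_out (@Fm v) (L1q m Iu) (mart m Iv Iu vu)).
- by congr Ex; apply/funext => w; ring.
- apply: G_measurableM; first exact: sigma_gen_coord.
  exact: (G_horner (p n s)).
- by apply: L2M => //; exact: L2q.
- by apply: L2M => //; exact: L2q.
Qed.

Lemma phat0 t : I t -> phat 0 t = 1.
Proof.
move=> It; have := orth 0 0 It; rewrite eqxx mulr1 => <-.
rewrite -[RHS](Ex_cst P 1); congr Ex; apply/funext => w.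
by rewrite /q p0// hornerC mulr1.
Qed.

(** An infinite support contains a point that is not a root of [p n t]; on a ball around it, of
    positive probability, the polynomial stays away from zero. *)
Lemma phat_gt0 n t : I t -> 0 < phat n t.
Proof.
move=> It; have E : phat n t = Ex P (fun w => q n t w * q n t w).
  by rewrite orth// eqxx mulr1.
rewrite lt_def; apply/andP; split; last first.
  by rewrite E; apply: Ex_ge0 => w; rewrite -expr2 sqr_ge0.
apply/eqP => ph0; apply: (Xinf It).
have pn0 : p n t != 0 by rewrite -size_poly_gt0 sz.
apply: sub_finite_set (finite_roots pn0) => y /= Xy.
apply: contraT => py.
have [e e0 eP] : exists2 e : R, 0 < e &
    forall x, ball y e x -> `|(p n t).[y]| / 2 < `|(p n t).[x]|.
  have /cvgrPdist_lt/(_ (`|(p n t).[y]| / 2)) := @continuous_horner R (p n t) y.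
  rewrite divr_gt0 ?normr_gt0// => /(_ isT)/nbhs_ballP[e /= e0 H].
  exists e => // x /H /= H'.
  have := ler_normB (p n t).[y] ((p n t).[y] - (p n t).[x]).
  have -> : (p n t).[y] - ((p n t).[y] - (p n t).[x]) = (p n t).[x] by ring.
  have := ler_distD ((p n t).[x]) (p n t).[y] 0; rewrite !subr0.
  by move: H'; lra.
pose A := X t @^-1` ball y e; pose c := `|(p n t).[y]| / 2.
have c0 : 0 < c by rewrite divr_gt0// normr_gt0.
have mA : measurable A.
  rewrite /A -[X in measurable X]setTI; apply: mX => //; exact: measurable_ball.
have PA : Ex P (\1_A) = fine (P A).
  by rewrite /Ex /Rintegral integral_indic// setIT.
have A1 : L1 P (\1_A) by exact: integrable_indic.
have H : Ex P (fun w => c ^+ 2 * \1_A w) <= Ex P (fun w => q n t w * q n t w).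
  apply: Ex_le; [exact: L1Z|by apply: L2M; exact: L2q|move=> w].
  rewrite indicE; have [|_] := boolP (w \in A); last first.
    by rewrite mulr0 -expr2 sqr_ge0.
  rewrite inE mulr1 => /eP; rewrite -/c => /ltW cq.
  by rewrite -expr2 -(real_normK (num_real (q n t w))) ler_sqr ?nnegrE ?normr_ge0 ?(ltW c0).
have := Xy e e0; rewrite /law /pushforward -/A => PA0.
move: H; rewrite -E ph0 ExZ// PA pmulr_rle0 ?exprn_gt0//.
rewrite leNgt fine_gt0//; apply/andP; split; first exact: PA0.
by rewrite (le_lt_trans (probability_le1 _ mA))// ltry.
Qed.

Lemma alpha_neq0 n t : I t -> alpha n.+1 t != 0.
Proof.
move=> It; apply/eqP => a0.
have pn0 : p n t != 0 by rewrite -size_poly_gt0 sz.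
have sX : size ('X * p n t) = n.+2 by rewrite mulrC size_mulX// sz.
have B1 : (size (beta n t *: p n t)%R <= n.+1)%N.
  by rewrite -(sz n It) size_scale_leq.
pose g : {poly R} := if n is k.+1 then gamma k t *: p k t else 0.
have B2 : (size g <= n.+1)%N.
  rewrite /g; case: (n) => [|k]; first by rewrite size_poly0.
  by apply: leq_trans (size_scale_leq _ _) _; rewrite sz// ltnW.
have := size_polyD (beta n t *: p n t) g.
have <- : 'X * p n t = beta n t *: p n t + g by rewrite rec// a0 scale0r add0r.
rewrite sX => H; have : (n.+2 <= n.+1)%N by apply: leq_trans H _; rewrite geq_max B1 B2.
by rewrite ltnn.
Qed.

Lemma jacobi_alpha n t : jacobi n.+1 n t = alpha n.+1 t.
Proof.
rewrite /jacobi eqxx (gtn_eqF (ltnSn n)) mulr1 mulr0 addr0.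
case: n => [|k]; first by rewrite addr0.
by rewrite (gtn_eqF (ltnW (ltnSn k.+1))) mulr0 addr0.
Qed.

Lemma jacobi_beta n t : jacobi n n t = beta n t.
Proof.
rewrite /jacobi eqxx (ltn_eqF (ltnSn n)) mulr1 mulr0 add0r.
by case: n => [|k]; rewrite ?addr0// (gtn_eqF (ltnSn k)) mulr0 addr0.
Qed.

Lemma jacobi_gamma n t : jacobi n n.+1 t = gamma n t.
Proof.
rewrite /jacobi eqxx (ltn_eqF (ltnSn n)) (ltn_eqF (ltnW (ltnSn n.+1))).
by rewrite !mulr0 !add0r mulr1.
Qed.

(** Multiplication by X is symmetric: E(X q_n q_{n+1}) is computed in two ways. *)
Lemma alpha_gamma n t : I t ->
  alpha n.+1 t * phat n.+1 t = gamma n t * phat n t.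
Proof.
move=> It; have E1 := Ex_mulX n.+1 n It It (lexx t).
have E2 := Ex_mulX n n.+1 It It (lexx t).
rewrite jacobi_alpha in E1; rewrite jacobi_gamma in E2.
rewrite -E1 -E2; congr Ex; apply/funext => w; ring.
Qed.

Lemma alpha_gamma_gt0 n t : I t -> 0 < alpha n.+1 t * gamma n t.
Proof.
move=> It; rewrite -(pmulr_lgt0 _ (phat_gt0 n It)) -mulrA -alpha_gamma//.
rewrite mulrA pmulr_lgt0; last exact: phat_gt0.
by rewrite -expr2 lt_def sqr_ge0 sqrf_eq0 alpha_neq0.
Qed.

Lemma gamma0E t : I t -> gamma 0 t = alpha 1 t * phat 1 t.
Proof. by move=> It; rewrite alpha_gamma// phat0// mulr1. Qed.

Lemma Ex_increment n s t : I s -> I t -> s <= t ->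
  Ex P (fun w => (q n t w - q n s w) ^+ 2) = phat n t - phat n s.
Proof.
move=> Is It st.
have E1 := Ex_pair n n Is It st; have E2 := orth n n It; have E3 := orth n n Is.
move: E1 E2 E3; rewrite eqxx !mulr1 => E1 E2 E3.
have L a b (Ia : I a) (Ib : I b) : L1 P (fun w => q n a w * q n b w).
  by apply: L2M; exact: L2q.
have -> : (fun w => (q n t w - q n s w) ^+ 2) = (fun w =>
    q n t w * q n t w - (2 * (q n t w * q n s w) - q n s w * q n s w)).
  by apply/funext => w; ring.
have H1 := L1Z 2 (L t s It Is); have H2 := L1B H1 (L s s Is Is).
rewrite (ExB (L t t It It) H2) (ExB H1 (L s s Is Is)) (ExZ _ (L t s It Is)) E1 E2 E3.
ring.
Qed.

Lemma phat_le n s t : I s -> I t -> s <= t -> phat n s <= phat n t.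
Proof.
move=> Is It st; rewrite -subr_ge0 -Ex_increment//.
by apply: Ex_ge0 => w; exact: sqr_ge0.
Qed.

Lemma harness_jacobi s t u c0 c1 c2 : I s -> I t -> I u -> s < t -> t < u ->
  is_cond_exp P (F_out I X s u) (X t) (fun w => c0 + c1 * X s w + c2 * X u w) ->
  forall n m,
    jacobi n m t = c0 * (n == m)%:R + c1 * jacobi n m s + c2 * jacobi n m u.
Proof.
move=> Is It Iu st tu H n m.
have su := lt_trans st tu.
have ph := phat_gt0 n Is.
have Fo : F_out I X s u `<=` measurable.
  by apply: sigma_gen_measurable => v [Iv _]; exact: mX.
have L2xi : L2 P (fun w => q n s w * q m u w) by exact: L2hh.
have L v (Iv : I v) : L1 P (fun w => X v w * (q n s w * q m u w)).
  by apply: L2M => //; exact: L2X.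
have Lxi := L2_L1 L2xi.
have E : (fun w => (c0 + c1 * X s w + c2 * X u w) * (q n s w * q m u w)) =
    (fun w => c0 * (q n s w * q m u w) + (c1 * (X s w * (q n s w * q m u w))
      + c2 * (X u w * (q n s w * q m u w)))).
  by apply/funext => w; ring.
have H0 := L1Z c0 Lxi; have H1 := L1Z c1 (L s Is); have H2 := L1Z c2 (L u Iu).
have H12 := L1D H1 H2.
apply: (mulIf (lt0r_neq0 ph)).
rewrite -(Ex_mulX_between n m Is It Iu (ltW st) (ltW tu)).
rewrite (cond_exp_pull_out Fo (L2_L1 (L2X It)) H).
- rewrite E (ExD H0 H12) (ExD H1 H2) (ExZ _ Lxi) (ExZ _ (L s Is)) (ExZ _ (L u Iu)).
  rewrite (Ex_mulX_between n m Is Is Iu (lexx s) (ltW su)).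
  rewrite (Ex_mulX_between n m Is Iu Iu (ltW su) (lexx u)).
  have -> : Ex P (fun w => q n s w * q m u w) = phat n s * (n == m)%:R.
    rewrite -(Ex_pair n m Is Iu (ltW su)); congr Ex; apply/funext => w; exact: mulrC.
  ring.
- by apply: G_measurableM; apply: G_horner; split=> //; rewrite ltxx ?andbF.
- exact: L.
- by rewrite E; exact: L1D.
Qed.

(* If [phat 1] does not grow from [s] to [t] then [X t] is almost surely an
   affine function of [X s]. *)
Lemma degenerate_jacobi s t : I s -> I t -> s <= t -> phat 1 s = phat 1 t ->
  forall n m, jacobi n m t =
    (beta 0 t - alpha 1 t / alpha 1 s * beta 0 s) * (n == m)%:R +
    alpha 1 t / alpha 1 s * jacobi n m s.
Proof.
move=> Is It st ph n m.
have phn := phat_gt0 n Is.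
have Xq1 v w : I v -> X v w = alpha 1 v * q 1 v w + beta 0 v.
  move=> Iv; have := Xq 0 w Iv.
  by rewrite /q p0// hornerC !mulr1 addr0.
set c := alpha 1 t / alpha 1 s.
have as0 := alpha_neq0 0 Is.
have L2xi : L2 P (fun w => q n s w * q m t w) by exact: L2hh.
have L2d : L2 P (fun w => q 1 t w - q 1 s w) by apply: L2B; exact: L2q.
(* Cauchy-Schwarz: the increment of p_1 has second moment phat 1 t - phat 1 s = 0. *)
have D0 : Ex P (fun w => (q 1 t w - q 1 s w) * (q n s w * q m t w)) = 0.
  have := Ex_cauchy_schwarz L2d L2xi.
  by rewrite Ex_increment// ph subrr mul0r => H; apply/eqP; rewrite -sqrf_eq0 eq_le H sqr_ge0.
have Ls : L1 P (fun w => X s w * (q n s w * q m t w)).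
  by apply: L2M => //; exact: L2X.
have Lxi := L2_L1 L2xi; have Ld := L2M L2d L2xi.
apply: (mulIf (lt0r_neq0 phn)).
rewrite -(Ex_mulX_between n m Is It It st (lexx t)).
have -> : (fun w => X t w * (q n s w * q m t w)) = (fun w =>
    (beta 0 t - c * beta 0 s) * (q n s w * q m t w) +
    (c * (X s w * (q n s w * q m t w)) +
     alpha 1 t * ((q 1 t w - q 1 s w) * (q n s w * q m t w)))).
  have cE : alpha 1 t = c * alpha 1 s by rewrite /c divfK.
  by apply/funext => w; rewrite (Xq1 t w It) (Xq1 s w Is) cE; ring.
have H0 := L1Z (beta 0 t - c * beta 0 s) Lxi; have H1 := L1Z c Ls.
have H2 := L1Z (alpha 1 t) Ld; have H12 := L1D H1 H2.
rewrite (ExD H0 H12) (ExD H1 H2) (ExZ _ Lxi) (ExZ _ Ls) (ExZ _ Ld) D0.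
rewrite Ex_mulX_between//.
have -> : Ex P (fun w => q n s w * q m t w) = phat n s * (n == m)%:R.
  rewrite -(Ex_pair n m Is It st); congr Ex; apply/funext => w; exact: mulrC.
ring.
Qed.

Hypothesis XM : Defs.markov P I X.
Hypothesis Xdet : forall t, I t -> moment_determinate P X t.

Lemma jacobi_harness s t u c0 c1 c2 : I s -> I t -> I u -> s < t -> t < u ->
  (forall n m,
    jacobi n m t = c0 * (n == m)%:R + c1 * jacobi n m s + c2 * jacobi n m u) ->
  is_cond_exp P (F_out I X s u) (X t) (fun w => c0 + c1 * X s w + c2 * X u w).
Proof.
move=> Is It Iu st tu J; have su := lt_trans st tu.
pose lin w := c0 + c1 * X s w + c2 * X u w.
have Fo : F_out I X s u `<=` measurable.
  by apply: sigma_gen_measurable => v [Iv _]; exact: mX.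
have L2lin : L2 P lin.
  by apply: L2D; [apply: L2D; [exact: L2_cst|]|]; apply: L2Z; exact: L2X.
have L2W : L2 P (fun w => X t w - lin w) by apply: L2B => //; exact: L2X.
have Glin C : G_measurable <<s C >> (X s) -> G_measurable <<s C >> (X u) ->
    G_measurable <<s C >> lin.
  move=> Gs Gu; apply: G_measurableD; last first.
    by apply: G_measurableM => //; exact: G_measurable_cst.
  apply: G_measurableD; first exact: G_measurable_cst.
  by apply: G_measurableM => //; exact: G_measurable_cst.
have GW : G_measurable (F_le I X u) (fun w => X t w - lin w).
  have -> : (fun w => X t w - lin w) = (fun w => X t w + (-1) * lin w).
    by apply/funext => w; rewrite mulN1r.
  apply: G_measurableD; first by apply: F_le_coord => //; exact: ltW.
  apply: G_measurableM; first exact: G_measurable_cst.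
  by apply: Glin; apply: F_le_coord => //; exact: ltW.
have key A n : F_le I X s A ->
    Ex P (fun w => (X t w - lin w) * \1_A w * q n u w) = 0.
  move=> FA; have mA := Fm FA.
  (* By the martingale property this number serves every time v >= s, so that below only the
     recurrence coefficients depend on [v]. *)
  pose e k := Ex P (fun w => q k s w * \1_A w).
  have qe k v : I v -> s <= v -> Ex P (fun w => q k v w * \1_A w) = e k.
    move=> Iv sv; rewrite /e.
    exact: (cond_exp_indic (@Fm s) (L1q k Iv) (mart k Is Iv sv) FA).
  have L2A v (Iv : I v) : L2 P (fun w => X v w * \1_A w).
    by apply: L2_indic => //; exact: L2X.
  pose J' v := alpha n.+1 v * e n.+1 + beta n v * e n +
    (if n is k.+1 then gamma k v * e k else 0).
  have XA v : I v -> s <= v -> v <= u ->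
      Ex P (fun w => q n u w * (X v w * \1_A w)) = J' v.
    move=> Iv sv vu.
    rewrite (cond_exp_pull_out (@Fm v) (L1q n Iu) (mart n Iv Iu vu)); first last.
    - by apply: L2M; [exact: L2q|exact: L2A].
    - by apply: L2M; [exact: L2q|exact: L2A].
    - apply: G_measurableM; first exact: F_le_coord.
      by apply: G_measurable_indic; exact: F_le_le sv _ FA.
    have Lk k : L1 P (fun w => q k v w * \1_A w) by apply: L1_indic => //; exact: L1q.
    have H1 := L1Z (alpha n.+1 v) (Lk n.+1); have H2 := L1Z (beta n v) (Lk n).
    have -> : (fun w => q n v w * (X v w * \1_A w)) =
      (fun w => alpha n.+1 v * (q n.+1 v w * \1_A w) + beta n v * (q n v w * \1_A w)
         + (if n is k.+1 then gamma k v * (q k v w * \1_A w) else 0)).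
      apply/funext => w; rewrite mulrA (mulrC (q n v w)) Xq//.
      by case: (n) => [|k]; ring.
    have [H4 E4] : L1 P (fun w => if n is k.+1 then gamma k v * (q k v w * \1_A w) else 0) /\
        Ex P (fun w => if n is k.+1 then gamma k v * (q k v w * \1_A w) else 0) =
        (if n is k.+1 then gamma k v * e k else 0).
      case: (n) => [|k]; first by split; [exact: L1_cst|rewrite Ex_cst].
      by split; [exact: L1Z (Lk k)|rewrite (ExZ _ (Lk k)) qe].
    rewrite (ExD (L1D H1 H2) H4) E4 (ExD H1 H2) (ExZ _ (Lk n.+1)) (ExZ _ (Lk n)).
    by rewrite !qe.
  have JJ : J' t = c0 * e n + c1 * J' s + c2 * J' u.
    have := J n n; have := J n.+1 n; rewrite !jacobi_alpha !jacobi_beta eqxx.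
    rewrite (gtn_eqF (ltnSn n)) mulr0 mulr1 add0r => Ja Jb.
    have Jg : (if n is k.+1 then gamma k t * e k else 0) =
        c1 * (if n is k.+1 then gamma k s * e k else 0) +
        c2 * (if n is k.+1 then gamma k u * e k else 0).
      case: (n) => [|k]; first by rewrite !mulr0 addr0.
      have := J k k.+1; rewrite !jacobi_gamma (ltn_eqF (ltnSn k)) mulr0 add0r => ->; ring.
    rewrite /J' Ja Jb Jg.
    move: (match n with 0%N => 0 | k.+1 => gamma k s * e k end)
      (match n with 0%N => 0 | k.+1 => gamma k u * e k end) => gs gu; ring.
  have L v (Iv : I v) : L1 P (fun w => q n u w * (X v w * \1_A w)).
    by apply: L2M; [exact: L2q|exact: L2A].
  have Lq : L1 P (fun w => q n u w * \1_A w) by apply: L1_indic => //; exact: L1q.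
  have -> : (fun w => (X t w - lin w) * \1_A w * q n u w) =
    (fun w => q n u w * (X t w * \1_A w) - (c0 * (q n u w * \1_A w) +
      (c1 * (q n u w * (X s w * \1_A w)) + c2 * (q n u w * (X u w * \1_A w))))).
    by apply/funext => w; rewrite /lin; ring.
  have H0 := L1Z c0 Lq; have H1 := L1Z c1 (L s Is); have H2 := L1Z c2 (L u Iu).
  have H12 := L1D H1 H2; have H012 := L1D H0 H12.
  rewrite (ExB (L t It) H012) (ExD H0 H12) (ExD H1 H2).
  rewrite (ExZ _ Lq) (ExZ _ (L s Is)) (ExZ _ (L u Iu)).
  rewrite (XA s) ?(XA t) ?(XA u) ?qe ?lexx ?(ltW st) ?(ltW tu) ?(ltW su)//.
  by rewrite JJ; ring.
have W0 A B : F_le I X s A -> measurable B ->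
    Ex P (fun w => (X t w - lin w) * \1_A w * \1_(X u @^-1` B) w) = 0.
  move=> FA mB; have mA := Fm FA.
  have L2WA := L2_indic mA L2W.
  apply: (determinate_orthogonal (mX Iu) (fun n => X1 n Iu) (Xdet Iu)) => // n.
  pose l (r : {poly R}) := Ex P (fun w => (X t w - lin w) * \1_A w * r.[X u w]).
  have Lr (r : {poly R}) : L1 P (fun w => (X t w - lin w) * \1_A w * r.[X u w]).
    by apply: L2M => //; exact: L2h.
  (* [key] gives orthogonality to the polynomials [p k u]; their degrees make them a basis, so the
     powers of [X u] follow. *)
  have := @poly_graded_eq0 _ l (fun n => p n u) (fun n => sz n Iu) _ _ _ 'X^n.
  rewrite /l => <-; first by congr Ex; apply/funext => w; rewrite hornerXn.
  - move=> r r'; rewrite -(ExD (Lr r) (Lr r')); congr Ex; apply/funext => w.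
    by rewrite hornerD mulrDr.
  - move=> k r; rewrite -(ExZ _ (Lr r)); congr Ex; apply/funext => w.
    by rewrite hornerZ mulrCA.
  - by move=> k; exact: key.
split.
- by apply: Glin; apply: sigma_gen_coord; split=> //; rewrite ltxx ?andbF.
- exact: L2_L1 L2lin.
move=> A FA; have mA := Fo A FA.
have Xt1 := L2_L1 (L2X It); have lin1 := L2_L1 L2lin.
rewrite (integral_indic_Ex mA lin1) (integral_indic_Ex mA Xt1); congr (_%:E).
apply/esym/eqP; rewrite -subr_eq0 -ExB; [|exact: L1_indic|exact: L1_indic].
rewrite -[X in _ == X](F_out_eq0 mX XM Is Iu su GW (L2_L1 L2W) W0 FA).
by apply/eqP; congr Ex; apply/funext => w; rewrite mulrBl.
Qed.

End opm.

(** If (a, g) has nonzero determinant at some s < u, each f t is a combination of f s and f u with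
    weights common to the family, and Cramer's rule expresses it by [a] and [g]. For t outside
    [s, u] the three-point relation is solved for its outer term; the weight to be inverted is
    nonzero, as otherwise the determinant would vanish. If no such pair exists, every member is a
    multiple of [a]. *)
Lemma two_dimensional_span (R : realFieldType) (I : set R) (a g : R -> R)
    (fam : set (R -> R)) : fam a -> fam g -> (forall t, I t -> a t != 0) ->
  (forall s t u, I s -> I t -> I u -> s < t -> t < u -> exists c1 c2,
     forall f, fam f -> f t = c1 * f s + c2 * f u) ->
  (forall s t, I s -> I t -> s < t -> a s * g t = a t * g s ->
     forall f, fam f -> f t = a t / a s * f s) ->
  forall f, fam f -> exists k kh, forall t, I t -> f t = k * a t + kh * g t.
Proof.
move=> fa fg a0 H1 H2 f ff.
have [[s [u [Is Iu su D]]]|nD] := pselect (exists s u,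
    [/\ I s, I u, s < u & a s * g u - a u * g s != 0]); last first.
  have [[s Is]|I0] := pselect (exists s, I s); last first.
    by exists 0, 0 => t It; exfalso; apply: I0; exists t.
  have det v w : I v -> I w -> v < w -> a v * g w = a w * g v.
    move=> Iv Iw vw; apply/eqP; rewrite -subr_eq0; apply: contraT => D.
    by exfalso; apply: nD; exists v, w.
  exists (f s / a s), 0 => t It; rewrite mul0r addr0.
  have [st|ts|->] := ltgtP s t.
  - by rewrite (H2 s t Is It st (det s t Is It st) f ff); ring.
  - rewrite (H2 t s It Is ts (det t s It Is ts) f ff).
    by field; rewrite !a0.
  - by rewrite divfK// a0.
set De := a s * g u - a u * g s in D.
exists ((f s * g u - f u * g s) / De), ((a s * f u - a u * f s) / De) => t It.
have [x [y xy]] : exists x y, forall f, fam f -> f t = x * f s + y * f u.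
  have [st|ts|<-] := ltgtP s t; last first.
  - by exists 1, 0 => h _; rewrite mul1r mul0r addr0.
  - have [c1 [c2 c12]] := H1 t s u It Is Iu ts su.
    have c10 : c1 != 0.
      apply: contra_neq D => c10; rewrite /De (c12 a fa) (c12 g fg) c10.
      ring.
    exists c1^-1, (- (c2 / c1)) => h fh; rewrite (c12 h fh); field.
    exact: c10.
  - have [tu|ut|->] := ltgtP t u.
    + by have [c1 [c2 c12]] := H1 s t u Is It Iu st tu; exists c1, c2.
    + have [c1 [c2 c12]] := H1 s u t Is Iu It su ut.
      have c20 : c2 != 0.
        apply: contra_neq D => c20; rewrite /De (c12 a fa) (c12 g fg) c20.
        ring.
      exists (- (c1 / c2)), c2^-1 => h fh; rewrite (c12 h fh); field.
      exact: c20.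
    + by exists 0, 1 => h _; rewrite mul1r mul0r add0r.
rewrite (xy f ff) (xy a fa) (xy g fg).
rewrite /De; field; exact: D.
Qed.

Theorem theorem3 (R : realType) (d : measure_display) (T : measurableType d)
  (P : probability T R) (I : set R) (X : R -> T -> R)
  (p : nat -> R -> {poly R}) (eta : R -> R -> R -> probability R R)
  (alpha beta gamma : nat -> R -> R) :
  is_interval I -> (exists s t, I s /\ I t /\ s < t) ->
  OPM P I X p ->
  transition_law P I X eta ->
  L2_density_condition P I X eta ->
  (forall (n : nat) t, I t ->
     'X * p n t = alpha n.+1 t *: p n.+1 t + beta n t *: p n t
                  + (if n is k.+1 then gamma k t *: p k t else 0)) ->
  harness P I X <->
  exists a ah b bh c ch : nat -> R,
    [/\ [/\ b 0%N = 0, bh 0%N = 0, ah 0%N = 0, a 0%N = 0 & ah 1%N = 0],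
        [/\ c 0%N = 0, a 1%N = 1 & ch 0%N = 1],
        forall (n : nat) t, I t ->
          [/\ beta n t = beta 0%N t + b n * alpha 1%N t + bh n * gamma 0%N t,
              (0 < n)%N -> alpha n t = a n * alpha 1%N t + ah n * gamma 0%N t &
              gamma n t = c n * alpha 1%N t + ch n * gamma 0%N t] &
        forall (n : nat) t, I t -> (0 < n)%N -> 0 < alpha n t * gamma n.-1 t].
Proof.
move=> _ _ [[[mX X1 Xinf Xdet XM] _] sz p0 [phat orth'] mart] _ _ rec.
have orth n m t : I t -> Ex P (fun w => (p n t).[X t w] * (p m t).[X t w]) =
    phat n t * (n == m)%:R.
  by move=> It; rewrite /Ex /Rintegral orth'.
have X1' t n : I t -> L1 P (fun w => X t w ^+ n) by move=> It; exact: X1.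
pose J := jacobi alpha beta gamma.
have a0 n t : I t -> alpha n.+1 t != 0 by exact: (alpha_neq0 sz rec).
have g0E t : I t -> gamma 0 t = alpha 1 t * phat 1 t.
  exact: (gamma0E mX X1' p0 orth mart rec).
split=> [H|[a [ah [b [bh [c [ch [[b0 bh0 ah0 a00 ah1] [c0 a1 ch0] coef _]]]]]]]].
  (* Subtracting beta_0 removes the constant c0, which enters the diagonal entries only. *)
  pose fam : set (R -> R) := [set f | exists n, [\/ f = alpha n.+1, f = gamma n |
    f = (fun t => beta n t - beta 0 t)]].
  have fa n : fam (alpha n.+1) by exists n; constructor 1.
  have fg n : fam (gamma n) by exists n; constructor 2.
  have fb n : fam (fun t => beta n t - beta 0 t) by exists n; constructor 3.
  have famJ s t u c0 c1 c2 : (forall n m, J n m t = c0 * (n == m)%:R +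
      c1 * J n m s + c2 * J n m u) ->
      forall f, fam f -> f t = c1 * f s + c2 * f u.
    move=> HJ _ [n [->|->|->]].
    - have := HJ n.+1 n; rewrite /J !jacobi_alpha => ->.
      by rewrite (gtn_eqF (ltnSn n)) mulr0 add0r.
    - have := HJ n n.+1; rewrite /J !jacobi_gamma => ->.
      by rewrite (ltn_eqF (ltnSn n)) mulr0 add0r.
    - have := HJ n n; have := HJ 0%N 0%N; rewrite /J !jacobi_beta !eqxx => -> ->.
      ring.
  have H1 s t u : I s -> I t -> I u -> s < t -> t < u -> exists c1 c2,
      forall f, fam f -> f t = c1 * f s + c2 * f u.
    move=> Is It Iu st tu; have [c0 [c1 [c2 Hc]]] := H s t u Is It Iu st tu.
    exists c1, c2; apply: (famJ s t u c0).
    exact: (harness_jacobi mX X1' Xinf sz orth mart rec Is It Iu st tu Hc).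
  have H2 s t : I s -> I t -> s < t ->
      alpha 1 s * gamma 0 t = alpha 1 t * gamma 0 s ->
      forall f, fam f -> f t = alpha 1 t / alpha 1 s * f s.
    move=> Is It st E f ff.
    have ph : phat 1%N s = phat 1%N t.
      have A : alpha 1 s * alpha 1 t != 0 by rewrite mulf_neq0 ?a0.
      apply: (mulfI A); move: E; rewrite !g0E// => E.
      by rewrite -mulrA mulrCA -E; ring.
    have D := degenerate_jacobi mX X1' Xinf sz p0 orth mart rec Is It (ltW st) ph.
    (* The triple s, t, s with last weight 0 gives the degenerate relation the shape required by
       [famJ]. *)
    rewrite (famJ s t s (beta 0 t - alpha 1 t / alpha 1 s * beta 0 s)
      (alpha 1 t / alpha 1 s) 0)//; first by rewrite mul0r addr0.
    by move=> n m; rewrite mul0r addr0; exact: D.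
  have span := two_dimensional_span (fa 0%N) (fg 0%N) (a0 0%N) H1 H2.
  have pair f : fam f -> exists x : R * R, forall t, I t ->
      f t = x.1 * alpha 1 t + x.2 * gamma 0 t.
    by move=> /span[k [kh Hk]]; exists (k, kh).
  have /choice[A AP] := fun n => pair _ (fa n).
  have /choice[B BP] := fun n => pair _ (fb n).
  have /choice[C CP] := fun n => pair _ (fg n).
  (* [A n] belongs to alpha n.+1, whence the shift by one; the values at 0 and 1 are the prescribed
     normalisations. *)
  exists (fun n => if n is k.+2 then (A k.+1).1 else n%:R).
  exists (fun n => if n is k.+2 then (A k.+1).2 else 0).
  exists (fun n => if n is 0%N then 0 else (B n).1).
  exists (fun n => if n is 0%N then 0 else (B n).2).
  exists (fun n => if n is 0%N then 0 else (C n).1).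
  exists (fun n => if n is 0%N then 1 else (C n).2).
  split=> // [n t It|[//|n] t It _]; last first.
    exact: (alpha_gamma_gt0 mX X1' Xinf sz orth mart rec n It).
  split.
  - case: n => [|n]; first by rewrite !mul0r !addr0.
    by have := BP n.+1 t It; lra.
  - case: n => [//|[|n]] _; first by rewrite mul1r mul0r addr0.
    exact: AP.
  - case: n => [|n]; first by rewrite mul1r mul0r add0r.
    exact: CP.
move=> s t u Is It Iu st tu; have su := lt_trans st tu.
have [c1 [c2 [ca cg]]] : exists c1 c2,
    alpha 1 t = c1 * alpha 1 s + c2 * alpha 1 u /\
    gamma 0 t = c1 * gamma 0 s + c2 * gamma 0 u.
  (* A zero determinant means that phat 1 agrees at [s] and [u], hence at [t] by monotonicity, so
     gamma_0 is the same multiple of alpha_1 at all three times. Otherwise Cramer's rule applies. *)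
  have [D|D] := eqVneq (alpha 1 s * gamma 0 u) (alpha 1 u * gamma 0 s).
    have ple := phat_le mX X1' orth mart.
    have ph : phat 1%N s = phat 1%N u.
      have A : alpha 1 s * alpha 1 u != 0 by rewrite mulf_neq0 ?a0.
      apply: (mulfI A); move: D; rewrite !g0E// => D.
      by rewrite -mulrA mulrCA -D; ring.
    have pht : phat 1%N t = phat 1%N s.
      apply/eqP; rewrite eq_le {1}ph !ple// ltW//.
    exists (alpha 1 t / alpha 1 s), 0; rewrite !mul0r !addr0.
    have as0 := a0 0%N s Is.
    by split; [rewrite divfK|rewrite !g0E// pht mulrA divfK].
  rewrite -subr_eq0 in D; set De := _ - _ in D.
  exists ((alpha 1 t * gamma 0 u - alpha 1 u * gamma 0 t) / De).
  exists ((alpha 1 s * gamma 0 t - alpha 1 t * gamma 0 s) / De).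
  by split; apply: (mulIf D); rewrite mulrDl -![_ / De * _ * De]mulrAC !divfK// /De; ring.
(* The constant is forced by the entry n = m = 0 of the Jacobi relation. *)
exists (beta 0 t - c1 * beta 0 s - c2 * beta 0 u), c1, c2.
apply: (jacobi_harness mX X1' sz mart rec XM Xdet) => // n m.
rewrite /jacobi.
have Ha k : alpha k.+1 t = c1 * alpha k.+1 s + c2 * alpha k.+1 u.
  have [_ -> // _] := coef k.+1 t It; have [_ -> // _] := coef k.+1 s Is.
  by have [_ -> // _] := coef k.+1 u Iu; rewrite ca cg; ring.
have Hg k : gamma k t = c1 * gamma k s + c2 * gamma k u.
  have [_ _ ->] := coef k t It; have [_ _ ->] := coef k s Is.
  by have [_ _ ->] := coef k u Iu; rewrite ca cg; ring.
have Hb k : beta k t = beta 0 t - c1 * beta 0 s - c2 * beta 0 u +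
    c1 * beta k s + c2 * beta k u.
  have [-> _ _] := coef k t It; have [-> _ _] := coef k s Is.
  by have [-> _ _] := coef k u Iu; rewrite ca cg; ring.
by case: m => [|k]; rewrite Ha Hb ?Hg; ring.
Qed.
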